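(* Let $\mathcal{H}$ be a hereditary property of $3$-graphs such that $k\otimes U(k)\in\mathrm{Trip}(\mathcal{H})$ for all $k\geq1$. Then there are $c>0$ and $\epsilon^*>0$ such that for every $0<\epsilon_1<\epsilon^*$ there exists $\epsilon_2:\mathbb{N}\to(0,1]$ with $T_{\mathcal{H}}(\epsilon_1,\epsilon_2)\geq W(c\,\epsilon_1^{-1/7})$.
   Context: A $3$-graph is a pair $H=(V,E)$ with $E$ a set of $3$-element subsets of $V$; write $xyz$ for $\{x,y,z\}$ and $\overline{E}=\{(x,y,z)\in V^3: xyz\in E\}$. A hereditary property of $3$-graphs is a class of finite $3$-graphs closed under isomorphism and induced sub-$3$-graphs. For a graph $G=(V,E)$ and $n\geq1$, $n\otimes G$ is the $3$-graph with vertex set $V\cup C$, where $C$ is a new set of $n$ vertices disjoint from $V$, and edge set $\{xyz: xy\in E, z\in C\}$. $U(k)$ is the graph with vertex set $\{a_i:i\in[k]\}\cup\{b_S:S\subseteq[k]\}$ and edge set $\{a_ib_S: i\in S\}$. For a $3$-graph $H=(V,E)$, $\mathrm{Trip}(H)$ is the $3$-graph with vertex set $\{a_v,b_v,c_v:v\in V\}$ (all distinct) and edge set $\{a_vb_{v'}c_{v''}: vv'v''\in E\}$. $\mathrm{Trip}(\mathcal{H})$ is the closure under isomorphism and induced sub-$3$-graphs of $\{\mathrm{Trip}(H):H\in\mathcal{H}\}$. A bigraph is $B=(U,W;E)$ with $E\subseteq U\times W$; density $d_B=|E|/(|U||W|)$. $B$ has $\mathrm{dev}_2(\epsilon,d)$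 if $|d_B-d|\leq\epsilon$ and $\sum_{u_0,u_1\in U}\sum_{w_0,w_1\in W}\prod_{i,j\in\{0,1\}}g(u_i,w_j)\leq\epsilon|U|^2|W|^2$, where $g(u,w)=1-d_B$ if $(u,w)\in E$ and $-d_B$ otherwise; $\mathrm{dev}_2(\epsilon)$ means $\mathrm{dev}_2(\epsilon,d_B)$. A triad is $G=(X,Y,Z;E_{XY},E_{XZ},E_{YZ})$ with $E_{XY}\subseteq X\times Y$, $E_{XZ}\subseteq X\times Z$, $E_{YZ}\subseteq Y\times Z$; $K_3(G)=\{(x,y,z)\in X\times Y\times Z:(x,y)\in E_{XY},(x,z)\in E_{XZ},(y,z)\in E_{YZ}\}$. For a $3$-graph $H=(V,E)$ and triad $G$ with vertex sets in $V$, let $d=|\overline{E}\cap K_3(G)|/|K_3(G)|$; $G$ has $\mathrm{dev}_{2,3}(\epsilon_1,\epsilon_2)$ w.r.t. $H$ if there are $d_{XY},d_{XZ},d_{YZ}>0$ such that $(X,Y;E_{XY}),(X,Z;E_{XZ}),(Y,Z;E_{YZ})$ have $\mathrm{dev}_2(\epsilon_2,d_{XY}),\mathrm{dev}_2(\epsilon_2,d_{XZ}),\mathrm{dev}_2(\epsilon_2,d_{YZ})$ and $\sum_{u_0,u_1\in X}\sum_{w_0,w_1\in Y}\sum_{z_0,z_1\in Z}\prod_{(i,j,k)\in\{0,1\}^3}h(u_i,w_j,z_k)\leq\epsilon_1d_{XY}^4d_{XZ}^4d_{YZ}^4|X|^2|Y|^2|Z|^2$, with $h=1-d$ on $\overline{E}\cap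 K_3(G)$, $h=-d$ on $K_3(G)\setminus\overline{E}$, $h=0$ off $K_3(G)$. A $(t,\ell)$-decomposition $\mathcal{P}$ of $V$: a partition $\{V_1,\ldots,V_t\}$ of $V$ and, for each $1\leq i,j\leq t$, a partition $V_i\times V_j=P_{ij}^1\cup\cdots\cup P_{ij}^\ell$; its triads are $(V_i,V_j,V_k;P_{ij}^\alpha,P_{ik}^\beta,P_{jk}^\gamma)$, whose $K_3$'s partition $V^3$. It is a $(t,\ell,\epsilon_1,\epsilon_2)$-decomposition if for at least $(1-\epsilon_1)|V|^2$ pairs $(x,y)\in V^2$ the part $P_{ij}^\alpha\ni(x,y)$ gives a bigraph $(V_i,V_j;P_{ij}^\alpha)$ with $\mathrm{dev}_2(\epsilon_2)$; it is $\mathrm{dev}_{2,3}(\epsilon_1,\epsilon_2)$-regular w.r.t. $H$ if for all but at most $\epsilon_1|V|^3$ triples $(x,y,z)\in V^3$ the triad $G$ with $(x,y,z)\in K_3(G)$ has $\mathrm{dev}_{2,3}(\epsilon_1,\epsilon_2)$ w.r.t. $H$. $T_{\mathcal{H}}(\epsilon_1,\epsilon_2)$ (for $\epsilon_1>0$, $\epsilon_2:\mathbb{N}\to(0,1]$) is the least $T$ for which there are $L\geq1$ and $n_0$ such that every $H\in\mathcal{H}$ on at least $n_0$ vertices has, for some $1\leq t\leq T$, $1\leq\ell\leq L$, a $(t,\ell,\epsilon_1,\epsilon_2(\ell))$-decomposition of its vertex set that is $\mathrm{dev}_{2,3}(\epsilon_1,\epsilon_2(\ell))$-regular w.r.t.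 $H$. Wowzer function: $T_m(1)=m$, $T_m(x+1)=T_m(x)2^{T_m(x)}$; $W(1)=1$, $W(x+1)=T_2(W(x))$; for real $y>0$, $W(y)$ means $W(\lceil y\rceil)$. *)

(* Defs.v *)
From HB Require Import structures.
From mathcomp Require Import all_boot all_order all_algebra.
From mathcomp Require Import boolp classical_sets reals constructive_ereal ereal.
From mathcomp Require Import exp.

Set Implicit Arguments.
Unset Strict Implicit.
Unset Printing Implicit Defensive.

Import Order.TTheory GRing.Theory Num.Theory.

Local Open Scope ring_scope.

Record graph3 := Graph3 {
  vert3 :> finType;
  edges3 : {set {set vert3}};
  edges3_card : forall e : {set vert3}, e \in edges3 -> #|e| = 3%N }.

Definition iso3 (G H : graph3) : Prop :=
  exists2 f : G -> H, bijective f
    & forall e : {set G}, (f @: e \in edges3 H) = (e \in edges3 G).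

Section Induced.
Variables (G : graph3) (A : {set G}).

Definition induced3_edges : {set {set {x : G | x \in A}}} :=
  [set e : {set {x : G | x \in A}} | val @: e \in edges3 G].

Lemma induced3_card (e : {set {x : G | x \in A}}) : e \in induced3_edges -> #|e| = 3%N.
Proof.
by rewrite inE => /edges3_card; rewrite card_imset //; exact: val_inj.
Qed.

Definition induced3 : graph3 := Graph3 induced3_card.

End Induced.

Definition hereditary3 (P : graph3 -> Prop) : Prop :=
  (forall G H, iso3 G H -> P G -> P H) /\
  (forall (G : graph3) (A : {set G}), P G -> P (induced3 A)).

Inductive hereditary_closure (P : graph3 -> Prop) : graph3 -> Prop :=
| hclosure_base G : P G -> hereditary_closure P G
| hclosure_iso G H :
    iso3 G H -> hereditary_closure P G -> hereditary_closure P H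
| hclosure_induced (G : graph3) (A : {set G}) :
    hereditary_closure P G -> hereditary_closure P (induced3 A).

Record sgraph := SGraph {
  svert :> finType;
  sadj : rel svert;
  sadj_sym : symmetric sadj;
  sadj_irr : irreflexive sadj }.

Lemma cards3 (T : finType) (x y z : T) :
  x != y -> x != z -> y != z -> #|[set x; y; z]| = 3%N.
Proof.
move=> xy xz yz; rewrite finset.setUC cardsU1 cards2 !inE xy.
by rewrite !(eq_sym z) (negbTE xz) (negbTE yz).
Qed.

Section Otimes.
Variables (n : nat) (G : sgraph).

Definition otimes_edges : {set {set (G + 'I_n)%type}} :=
  [set e | [exists x : G, exists y : G, exists z : 'I_n,
     sadj x y && (e == [set inl x; inl y; inr z])]].

Lemma otimes_card (e : {set (G + 'I_n)%type}) : e \in otimes_edges -> #|e| = 3%N.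
Proof.
rewrite inE => /existsP[x /existsP[y /existsP[z /andP[xy /eqP->]]]].
apply: cards3 => //; apply: contraTneq xy => -[->].
by rewrite sadj_irr.
Qed.

Definition otimes : graph3 := Graph3 otimes_card.

End Otimes.

Section Ugraph.
Variable k : nat.

(* [inl i] is the vertex a_i and [inr A] is the vertex b_A. *)
Definition U_adj (x y : ('I_k + {set 'I_k})%type) : bool :=
  match x, y with
  | inl i, inr A | inr A, inl i => i \in A
  | _, _ => false
  end.

Lemma U_adj_sym : symmetric U_adj.
Proof. by move=> [i|A] [j|A']. Qed.

Lemma U_adj_irr : irreflexive U_adj.
Proof. by move=> [i|A]. Qed.

Definition Ugraph : sgraph := SGraph U_adj_sym U_adj_irr.

End Ugraph.

Section Trip.
Variable H : graph3.

Definition trip_vert : finType := (H + H + H)%type.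
Definition trip_a (v : H) : trip_vert := inl (inl v).
Definition trip_b (v : H) : trip_vert := inl (inr v).
Definition trip_c (v : H) : trip_vert := inr v.

Definition trip_edges : {set {set trip_vert}} :=
  [set e | [exists v : H, exists v' : H, exists v'' : H,
     ([set v; v'; v''] \in edges3 H) &&
     (e == [set trip_a v; trip_b v'; trip_c v''])]].

Lemma trip_card (e : {set trip_vert}) : e \in trip_edges -> #|e| = 3%N.
Proof.
rewrite inE => /existsP[v /existsP[v' /existsP[v'' /andP[_ /eqP->]]]].
exact: cards3.
Qed.

Definition Trip : graph3 := Graph3 trip_card.

End Trip.

Definition Trip_class (P : graph3 -> Prop) : graph3 -> Prop :=
  hereditary_closure (fun G => exists2 H : graph3, P H & G = Trip H).

Record bigraph (V : finType) := Bigraph {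
  bU : {set V};
  bW : {set V};
  bE : {set V * V};
  bE_sub : bE \subset finset.setX bU bW }.

Record triad (V : finType) := Triad {
  tX : {set V};
  tY : {set V};
  tZ : {set V};
  tXY : {set V * V};
  tXZ : {set V * V};
  tYZ : {set V * V};
  tXY_sub : tXY \subset finset.setX tX tY;
  tXZ_sub : tXZ \subset finset.setX tX tZ;
  tYZ_sub : tYZ \subset finset.setX tY tZ }.

Definition triad_bXY (V : finType) (G : triad V) : bigraph V :=
  Bigraph (tXY_sub G).
Definition triad_bXZ (V : finType) (G : triad V) : bigraph V :=
  Bigraph (tXZ_sub G).
Definition triad_bYZ (V : finType) (G : triad V) : bigraph V :=
  Bigraph (tYZ_sub G).

Definition K3 (V : finType) (G : triad V) : {set V * V * V} :=
  [set t | [&& t.1.1 \in tX G, t.1.2 \in tY G, t.2 \in tZ G,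
               (t.1.1, t.1.2) \in tXY G, (t.1.1, t.2) \in tXZ G
             & (t.1.2, t.2) \in tYZ G]].

Definition oedges (H : graph3) : {set H * H * H} :=
  [set t | [set t.1.1; t.1.2; t.2] \in edges3 H].

Section Dev.
Variable R : realType.

(* A density with empty denominator is 0 by the convention x / 0 = 0; this
   never matters in [dev2_decomposition] and [dev23_regular], which only look
   at bigraphs and triads containing a given pair or triple. *)
Definition bdensity (V : finType) (B : bigraph V) : R :=
  #|bE B|%:R / (#|bU B|%:R * #|bW B|%:R).

Definition bdev (V : finType) (B : bigraph V) (u w : V) : R :=
  if (u, w) \in bE B then 1 - bdensity B else - bdensity B.

Definition dev2 (V : finType) (B : bigraph V) (eps d : R) : Prop :=
  `|bdensity B - d| <= eps /\
  \sum_(u0 in bU B) \sum_(u1 in bU B) \sum_(w0 in bW B) \sum_(w1 in bW B)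
     \prod_(i : bool) \prod_(j : bool)
       bdev B (if i then u1 else u0) (if j then w1 else w0)
  <= eps * #|bU B|%:R ^+ 2 * #|bW B|%:R ^+ 2.

Definition dev2_self (V : finType) (B : bigraph V) (eps : R) : Prop :=
  dev2 B eps (bdensity B).

Definition tdensity (H : graph3) (G : triad H) : R :=
  #|oedges H :&: K3 G|%:R / #|K3 G|%:R.

Definition tdev (H : graph3) (G : triad H) (x y z : H) : R :=
  if (x, y, z) \in K3 G then
    if (x, y, z) \in oedges H then 1 - tdensity G else - tdensity G
  else 0.

Definition dev23 (H : graph3) (G : triad H) (eps1 eps2 : R) : Prop :=
  exists dXY dXZ dYZ : R,
  [/\ [/\ 0 < dXY, 0 < dXZ & 0 < dYZ],
      [/\ dev2 (triad_bXY G) eps2 dXY, dev2 (triad_bXZ G) eps2 dXZ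
        & dev2 (triad_bYZ G) eps2 dYZ]
    & \sum_(u0 in tX G) \sum_(u1 in tX G)
      \sum_(w0 in tY G) \sum_(w1 in tY G)
      \sum_(z0 in tZ G) \sum_(z1 in tZ G)
        \prod_(i : bool) \prod_(j : bool) \prod_(k : bool)
          tdev G (if i then u1 else u0) (if j then w1 else w0)
                 (if k then z1 else z0)
      <= eps1 * dXY ^+ 4 * dXZ ^+ 4 * dYZ ^+ 4
         * #|tX G|%:R ^+ 2 * #|tY G|%:R ^+ 2 * #|tZ G|%:R ^+ 2].

End Dev.

(* Parts are indexed and may be empty: the number l of pieces of
   V_i x V_j is the same for all (i, j), even when |V_i||V_j| < l. *)
Definition is_indexed_partition (I T : finType) (A : {set T}) (F : I -> {set T})
    : Prop :=
  \bigcup_(i : I) F i = A /\ forall i j, i != j -> [disjoint F i & F j].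

Record decomposition (V : finType) (t l : nat) := Decomposition {
  vpart : 'I_t -> {set V};
  ppart : 'I_t -> 'I_t -> 'I_l -> {set V * V};
  vpartP : is_indexed_partition [set: V] vpart;
  ppartP : forall i j,
    is_indexed_partition (finset.setX (vpart i) (vpart j)) (ppart i j) }.

Section Decomposition.
Variables (V : finType) (t l : nat) (P : decomposition V t l).

Lemma ppart_sub i j a :
  ppart P i j a \subset finset.setX (vpart P i) (vpart P j).
Proof. by have [<- _] := ppartP P i j; exact: finset.bigcup_sup. Qed.

Definition dec_bigraph (i j : 'I_t) (a : 'I_l) : bigraph V :=
  Bigraph (ppart_sub i j a).

Definition dec_triad (i j k : 'I_t) (a b c : 'I_l) : triad V :=
  Triad (ppart_sub i j a) (ppart_sub i k b) (ppart_sub j k c).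

End Decomposition.

Section Regularity.
Variable R : realType.

Definition dev2_decomposition (V : finType) (t l : nat)
    (P : decomposition V t l) (eps1 eps2 : R) : Prop :=
  (1 - eps1) * #|V|%:R ^+ 2 <=
  #|[set p : V * V | `[< exists i j a,
       p \in ppart P i j a /\ dev2_self (dec_bigraph P i j a) eps2 >]]|%:R.

Definition dev23_regular (H : graph3) (t l : nat)
    (P : decomposition H t l) (eps1 eps2 : R) : Prop :=
  #|~: [set p : H * H * H | `[< exists i j k a b c,
       p \in K3 (dec_triad P i j k a b c) /\
       dev23 (dec_triad P i j k a b c) eps1 eps2 >]]|%:R
  <= eps1 * #|H|%:R ^+ 3.

Definition T_bound (P : graph3 -> Prop) (eps1 : R) (eps2 : nat -> R) (T : nat)
    : Prop :=
  exists L n0 : nat, (1 <= L)%N /\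
  forall H : graph3, P H -> (n0 <= #|H|)%N ->
  exists t l : nat, [/\ (1 <= t <= T)%N, (1 <= l <= L)%N
    & exists D : decomposition H t l,
        dev2_decomposition D eps1 (eps2 l) /\ dev23_regular D eps1 (eps2 l)].

(* For a nonempty set of naturals the infimum is the least element; nonemptiness
   is the strong regularity lemma for 3-graphs. *)
Definition T_growth (P : graph3 -> Prop) (eps1 : R) (eps2 : nat -> R)
    : \bar R :=
  ereal_inf [set (T%:R)%:E | T in [set T : nat | T_bound P eps1 eps2 T]]%classic.

End Regularity.

(* Both functions are meant for arguments x >= 1; the value at 0 is junk. *)
Definition tower (m x : nat) : nat :=
  iter x.-1 (fun y => y * 2 ^ y)%N m.

Definition wowzer (x : nat) : nat := iter x.-1 (tower 2) 1%N.

Definition wowzerR (R : realType) (y : R) : nat := wowzer `|Num.ceil y|%N.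

(* Main.v *)
(** The sequence [eps2] is chosen after [eps1], so that [T_growth] can be forced
    above any prescribed number [N], in particular above a value of the wowzer
    function.  Since [k (x) U(k)] lies in [Trip HH], the class contains 3-graphs
    [H] with vertex sets [A], [B], [C] of size [n >= #|H| / 3] in which [xyz] is an
    edge exactly when [i \in S], where [x] lies in the block [A_i] and [y] in the
    block [B_S] of equipartitions of [A] and [B] indexed by [i : 'I_m] and
    [S : {set 'I_m}].  The sign matrix of [i \in S] has orthogonal rows, so for
    [m] much larger than [N ^ 2] both edges and non-edges have density close to 1/2
    between any [X :&: A] and [Y :&: B] with [#|X|], [#|Y|] at least [#|H| / (1000 N)].

    Let [(X, Y, Z; P, Q, S)] be a triad whose bigraphs are [d ^ 4]-quasirandom with
    [d] tiny compared with their densities [p, q, s] and with [1 / (m 2 ^ m)], and in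
    which [A], [B], [C] occupy a constant proportion of [X], [Y], [Z].  Restricting
    the octahedral sum of [h] to [A x B x C] decreases it, and there
    [h x y z * h x y z'] is nonnegative because adjacency does not depend on [z].
    The sum is therefore bounded below, up to a constant, by the number of octahedra
    in [(P', Q, S)] where [P'] is the set of edges (or of non-edges) inside [P].
    Three applications of Cauchy-Schwarz give
    [triangles ^ 8 <= e(Q) ^ 4 * (#|Y| ^ 2 * C4(S)) * C4(P') * octahedra],
    and counting triangles block by block shows that the octahedral sum exceeds
    [eps1 (p q s) ^ 4 #|X| ^ 2 #|Y| ^ 2 #|Z| ^ 2].  Hence no such triad is regular,
    while for [t <= N] almost all triples of [A x B x C] lie in such triads. *)
Require Import Defs.
From mathcomp Require Import all_boot all_order all_algebra.
From mathcomp Require Import boolp classical_sets reals constructive_ereal ereal.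
From mathcomp Require Import exp.
From mathcomp Require Import ring lra zify.

Set Implicit Arguments.
Unset Strict Implicit.
Unset Printing Implicit Defensive.

Import Order.TTheory GRing.Theory Num.Theory.

Local Open Scope ring_scope.

(** * Four-cycles and discrepancy *)

Section CauchySchwarz.
Variables (R : realFieldType).

(* Stated so that it can be iterated over nested sums. *)
Lemma sqr_sum_le (I : Type) (r : seq I) (P : pred I) (a b c : I -> R) :
  (forall i, P i -> 0 <= b i) -> (forall i, P i -> 0 <= c i) ->
  (forall i, P i -> a i ^+ 2 <= b i * c i) ->
  (\sum_(i <- r | P i) a i) ^+ 2 <=
  (\sum_(i <- r | P i) b i) * (\sum_(i <- r | P i) c i).
Proof.
move=> b0 c0 abc; set A := \sum_(i <- r | P i) a i.
set B := \sum_(i <- r | P i) b i; set C := \sum_(i <- r | P i) c i.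
(* Multiplying the hypotheses for [i] and [j] bounds [(a i * a j)^2] by [(b i * c j) * (c i * b j)],
   and AM-GM finishes. Summing over all pairs [(i, j)] then gives twice the claim. *)
have aux (i j : I) : P i -> P j -> 2 * (a i * a j) <= b i * c j + c i * b j.
  move=> Pi Pj; have [[bi bj] [ci cj]] := ((b0 i Pi, b0 j Pj), (c0 i Pi, c0 j Pj)).
  have bcij : 0 <= b i * c j + c i * b j by rewrite addr_ge0 ?mulr_ge0.
  apply: le_trans (ler_norm _) _; rewrite -(@ler_pXn2r _ 2) ?nnegrE //.
  rewrite -normrX ger0_norm ?sqr_ge0 //.
  have := ler_pM (sqr_ge0 _) (sqr_ge0 _) (abc i Pi) (abc j Pj).
  have := sqr_ge0 (b i * c j - c i * b j).
  rewrite (_ : (2 * (a i * a j)) ^+ 2 = 4 * (a i ^+ 2 * a j ^+ 2)); last by ring.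
  rewrite (_ : (b i * c j + c i * b j) ^+ 2 =
    (b i * c j - c i * b j) ^+ 2 + 4 * (b i * c i * (b j * c j))); last by ring.
  set x := (_ - _) ^+ 2; set y := _ ^+ 2 * _; set z := _ * _ * (_ * _).
  by move: x y z => x y z; lra.
have : 2 * (A * A) <= B * C + C * B.
  rewrite /A /B /C !big_distrlr /= mulr_sumr -big_split /=.
  apply: ler_sum => i Pi; rewrite mulr_sumr -big_split /=.
  by apply: ler_sum => j Pj; exact: aux.
by rewrite expr2; lra.
Qed.

Lemma sqr_sum_le_card (I : finType) (A : {set I}) (f : I -> R) :
  (\sum_(i in A) f i) ^+ 2 <= #|A|%:R * \sum_(i in A) f i ^+ 2.
Proof.
by rewrite -sumr_const; apply: sqr_sum_le => // i _; rewrite ?sqr_ge0 ?mul1r.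
Qed.

Lemma sqr_sum2_le_card (I : finType) (A : {set I}) (f : I -> I -> R) :
  (\sum_(i in A) \sum_(j in A) f i j) ^+ 2 <=
  #|A|%:R ^+ 2 * \sum_(i in A) \sum_(j in A) f i j ^+ 2.
Proof.
apply: le_trans (sqr_sum_le_card _ _) _.
rewrite expr2 -mulrA ler_wpM2l // mulr_sumr.
by apply: ler_sum => i _; exact: sqr_sum_le_card.
Qed.

Lemma sqr_sum_expand (I : finType) (A : pred I) (f : I -> R) :
  (\sum_(i | A i) f i) ^+ 2 = \sum_(i | A i) \sum_(j | A j) f i * f j.
Proof. by rewrite expr2 big_distrlr. Qed.

End CauchySchwarz.

Section Bipartite.
Variables (R : realFieldType) (S T : finType).
Implicit Types (X : {set S}) (Y : {set T}) (f g : S -> T -> R).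

Definition cycle4 X Y f : R :=
  \sum_(x0 in X) \sum_(x1 in X) \sum_(y0 in Y) \sum_(y1 in Y)
    f x0 y0 * f x0 y1 * f x1 y0 * f x1 y1.

Lemma cycle4_codegl X Y f :
  cycle4 X Y f = \sum_(x0 in X) \sum_(x1 in X) (\sum_(y in Y) f x0 y * f x1 y) ^+ 2.
Proof.
apply: eq_bigr => x0 _; apply: eq_bigr => x1 _; rewrite sqr_sum_expand.
by apply: eq_bigr => y0 _; apply: eq_bigr => y1 _; ring.
Qed.

Lemma cycle4_codegr X Y f :
  cycle4 X Y f = \sum_(y0 in Y) \sum_(y1 in Y) (\sum_(x in X) f x y0 * f x y1) ^+ 2.
Proof.
rewrite /cycle4; under eq_bigr do rewrite exchange_big.
rewrite exchange_big; apply: eq_bigr => y0 _ /=.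
under eq_bigr do rewrite exchange_big.
rewrite exchange_big; apply: eq_bigr => y1 _ /=.
rewrite sqr_sum_expand; apply: eq_bigr => x0 _; apply: eq_bigr => x1 _; ring.
Qed.

(** Expanding the square turns the second moment of the weighted degrees into a weighted sum of
    codegrees of pairs from [Y]. Cauchy-Schwarz over these pairs leaves the squared codegrees, which
    sum to [cycle4]. *)
Lemma wdeg_sqr_le X Y f (v : T -> R) : (forall y, `|v y| <= 1) ->
  (\sum_(x in X) (\sum_(y in Y) v y * f x y) ^+ 2) ^+ 2 <=
  #|Y|%:R ^+ 2 * cycle4 X Y f.
Proof.
move=> v1.
have -> : \sum_(x in X) (\sum_(y in Y) v y * f x y) ^+ 2 =
    \sum_(y0 in Y) \sum_(y1 in Y) v y0 * v y1 * \sum_(x in X) f x y0 * f x y1.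
  under eq_bigr do rewrite sqr_sum_expand.
  rewrite exchange_big; apply: eq_bigr => y0 _ /=.
  rewrite exchange_big; apply: eq_bigr => y1 _ /=.
  by rewrite mulr_sumr; apply: eq_bigr => x _; ring.
apply: le_trans (sqr_sum2_le_card _ _) _.
rewrite ler_wpM2l ?exprn_ge0 // cycle4_codegr.
apply: ler_sum => y0 _; apply: ler_sum => y1 _.
rewrite exprMn ler_piMl ?sqr_ge0 //.
by rewrite -real_normK ?num_real // expr_le1 // normrM mulr_ile1.
Qed.

(** Cauchy-Schwarz over [x] removes [u], and [wdeg_sqr_le] removes [v]. The two squarings are why
    the four-cycle bound carries [d ^+ 4] for a discrepancy of [d]. *)
Lemma cycle4_discrepancy X Y f (u : S -> R) (v : T -> R) (d : R) :
  (forall x, `|u x| <= 1) -> (forall y, `|v y| <= 1) -> 0 <= d ->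
  cycle4 X Y f <= d ^+ 4 * #|X|%:R ^+ 2 * #|Y|%:R ^+ 2 ->
  `|\sum_(x in X) \sum_(y in Y) u x * v y * f x y| <= d * #|X|%:R * #|Y|%:R.
Proof.
move=> u1 v1 d0 c4.
set D := \sum_(x in X) _.
have DE : D = \sum_(x in X) u x * \sum_(y in Y) v y * f x y.
  by apply: eq_bigr => x _; rewrite mulr_sumr; apply: eq_bigr => y _; ring.
set w := \sum_(x in X) (\sum_(y in Y) v y * f x y) ^+ 2.
have D2 : D ^+ 2 <= #|X|%:R * w.
  rewrite DE; apply: le_trans (sqr_sum_le_card _ _) _.
  rewrite ler_wpM2l //; apply: ler_sum => x _.
  rewrite exprMn ler_piMl ?sqr_ge0 //.
  by rewrite -real_normK ?num_real // expr_le1.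
have w2 := @wdeg_sqr_le X Y f v v1; rewrite -/w in w2.
have D4 : D ^+ 4 <= (d * #|X|%:R * #|Y|%:R) ^+ 4.
  rewrite (_ : 4 = 2 * 2)%N // exprM.
  apply: (@le_trans _ _ ((#|X|%:R * w) ^+ 2)).
    by rewrite lerXn2r // nnegrE ?sqr_ge0 // (le_trans _ D2) // sqr_ge0.
  rewrite exprMn; apply: (@le_trans _ _ (#|X|%:R ^+ 2 * (#|Y|%:R ^+ 2 * cycle4 X Y f))).
    by rewrite ler_wpM2l // exprn_ge0.
  apply: (@le_trans _ _ (#|X|%:R ^+ 2 * (#|Y|%:R ^+ 2 * (d ^+ 4 * #|X|%:R ^+ 2 * #|Y|%:R ^+ 2)))).
    by rewrite !ler_wpM2l // exprn_ge0.
  by rewrite le_eqVlt; apply/orP; left; apply/eqP; ring.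
rewrite -(@ler_pXn2r _ 4) ?nnegrE ?mulr_ge0 //.
by rewrite -normrX ger0_norm // (exprM _ 2 2) sqr_ge0.
Qed.

(** With [g = f - p], a codegree of [f] is a codegree of [g], plus two degree terms [p * h], plus
    [p ^+ 2 * #|Y|]. The square of a sum of four terms is at most 4 times the sum of their squares,
    and each of the four resulting sums is at most the main term [M], whence 16. *)
Lemma cycle4_le X Y f (p d : R) : 0 <= d <= p ->
  cycle4 X Y (fun x y => f x y - p) <= d ^+ 4 * #|X|%:R ^+ 2 * #|Y|%:R ^+ 2 ->
  cycle4 X Y f <= 16 * p ^+ 4 * #|X|%:R ^+ 2 * #|Y|%:R ^+ 2.
Proof.
have aux (c w M : R) : c <= M -> w <= M -> 4 * c + 8 * w + 4 * M <= 16 * M by lra.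
move=> /andP[d0 dp]; set g := fun x y => _ => c4.
pose h x := \sum_(y in Y) g x y.
set W := \sum_(x in X) h x ^+ 2.
have W0 : 0 <= W by apply: sumr_ge0 => x _; exact: sqr_ge0.
(* The degrees of [g] are controlled by its four-cycles through [wdeg_sqr_le] with constant weight
   1. *)
have WD : W <= d ^+ 2 * #|X|%:R * #|Y|%:R ^+ 2.
  rewrite -(@ler_pXn2r _ 2) ?nnegrE ?mulr_ge0 ?exprn_ge0 //.
  have := @wdeg_sqr_le X Y g (fun=> 1); rewrite normr1 => /(_ (fun=> lexx _)).
  rewrite (_ : \sum_(x in X) _ = W); last first.
    by apply: eq_bigr => x _; under eq_bigr do rewrite mul1r.
  move=> /le_trans; apply.
  apply: (@le_trans _ _ (#|Y|%:R ^+ 2 * (d ^+ 4 * #|X|%:R ^+ 2 * #|Y|%:R ^+ 2))).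
    by rewrite ler_wpM2l // exprn_ge0.
  by rewrite le_eqVlt; apply/orP; left; apply/eqP; ring.
set a : R := #|X|%:R in WD c4 *; set b : R := #|Y|%:R in WD c4 *.
have a0 : 0 <= a by []. have b0 : 0 <= b by [].
have codegE x0 x1 : \sum_(y in Y) f x0 y * f x1 y =
    \sum_(y in Y) g x0 y * g x1 y + p * h x0 + p * h x1 + p ^+ 2 * b.
  rewrite /h !mulr_sumr -!big_split /= /b -sumr_const mulr_sumr -big_split /=.
  by apply: eq_bigr => y _; rewrite /g; ring.
rewrite cycle4_codegl.
apply: (@le_trans _ _ (\sum_(x0 in X) \sum_(x1 in X)
   (4 * (\sum_(y in Y) g x0 y * g x1 y) ^+ 2 + 4 * p ^+ 2 * h x0 ^+ 2 +
    4 * p ^+ 2 * h x1 ^+ 2 + 4 * p ^+ 4 * b ^+ 2))).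
  apply: ler_sum => x0 _; apply: ler_sum => x1 _; rewrite codegE.
  set s := \sum_(y in Y) _; set t := p * h x0; set u := p * h x1; set v := p ^+ 2 * b.
  have := addr_ge0 (addr_ge0 (sqr_ge0 (s - t)) (sqr_ge0 (s - u))) (sqr_ge0 (s - v)).
  have := addr_ge0 (addr_ge0 (sqr_ge0 (t - u)) (sqr_ge0 (t - v))) (sqr_ge0 (u - v)).
  have -> : 4 * s ^+ 2 + 4 * p ^+ 2 * h x0 ^+ 2 + 4 * p ^+ 2 * h x1 ^+ 2 +
    4 * p ^+ 4 * b ^+ 2 = 4 * (s ^+ 2 + t ^+ 2 + u ^+ 2 + v ^+ 2).
    by rewrite /t /u /v; ring.
  by lra.
under eq_bigr do rewrite !big_split /= -!mulr_sumr !sumr_const.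
rewrite !big_split /= -!mulr_sumr !sumr_const -cycle4_codegl.
rewrite (_ : \sum_(i in X) h i * (h i *+ #|X|) = W * a); last first.
  by rewrite /W mulr_suml; apply: eq_bigr => x _; rewrite -mulr_natr mulrA.
rewrite -/W -(mulr_natr W) -(mulr_natr b) -/a -(mulr_natr (b * a)) -/a.
have d4 : d ^+ 4 <= p ^+ 4 by rewrite lerXn2r // nnegrE // (le_trans d0).
have d2 : d ^+ 2 <= p ^+ 2 by rewrite lerXn2r // nnegrE // (le_trans d0).
have W1 : p ^+ 2 * W * a <= p ^+ 4 * a ^+ 2 * b ^+ 2.
  rewrite (_ : p ^+ 4 * _ * _ = p ^+ 2 * (p ^+ 2 * a * b ^+ 2) * a); last by ring.
  rewrite ler_wpM2r // ler_wpM2l ?sqr_ge0 // (le_trans WD) //.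
  by rewrite !ler_wpM2r // exprn_ge0.
have c41 : cycle4 X Y g <= p ^+ 4 * a ^+ 2 * b ^+ 2.
  by rewrite (le_trans c4) // !ler_wpM2r // exprn_ge0.
set M := p ^+ 4 * a ^+ 2 * b ^+ 2 in W1 c41 *.
rewrite (_ : _ + _ = 4 * cycle4 X Y g + 8 * (p ^+ 2 * W * a) + 4 * M); last by rewrite /M; ring.
rewrite (_ : 16 * _ * _ * _ = 16 * M); last by rewrite /M; ring.
exact: aux c41 W1.
Qed.

End Bipartite.

(** * Triangles and octahedra *)

Section Tripartite.
Variables (R : realFieldType) (S T U : finType).
Variables (X : {set S}) (Y : {set T}) (Z : {set U}).
Variables (f : S -> T -> R) (g : S -> U -> R) (k : T -> U -> R).

(** Telescoping: replace [f] by [p], then [g] by [q], then [k] by [s]. With the third vertex fixed,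
    the factors not yet replaced are absorbed into the weights, so each of the three errors is a
    discrepancy sum of [cycle4_discrepancy]. The weights [u], [v], [w] allow the count to be
    localised to blocks. *)
Lemma triangle_count (p q s d : R) (u : S -> R) (v : T -> R) (w : U -> R) :
  (forall x, `|u x| <= 1) -> (forall y, `|v y| <= 1) -> (forall z, `|w z| <= 1) ->
  (forall x z, `|g x z| <= 1) -> (forall y z, `|k y z| <= 1) ->
  `|p| <= 1 -> `|q| <= 1 -> 0 <= d ->
  cycle4 X Y (fun x y => f x y - p) <= d ^+ 4 * #|X|%:R ^+ 2 * #|Y|%:R ^+ 2 ->
  cycle4 X Z (fun x z => g x z - q) <= d ^+ 4 * #|X|%:R ^+ 2 * #|Z|%:R ^+ 2 ->
  cycle4 Y Z (fun y z => k y z - s) <= d ^+ 4 * #|Y|%:R ^+ 2 * #|Z|%:R ^+ 2 ->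
  `|\sum_(z in Z) \sum_(x in X) \sum_(y in Y)
      u x * v y * w z * (f x y * g x z * k y z) -
    p * q * s * (\sum_(x in X) u x) * (\sum_(y in Y) v y) * (\sum_(z in Z) w z)|
  <= 3 * d * #|X|%:R * #|Y|%:R * #|Z|%:R.
Proof.
move=> u1 v1 w1 g1 k1 p1 q1 d0 cf cg ck.
set D1 := \sum_(z in Z) w z * \sum_(x in X) \sum_(y in Y)
  (u x * g x z) * (v y * k y z) * (f x y - p).
set D2 := \sum_(y in Y) v y * \sum_(x in X) \sum_(z in Z)
  u x * (w z * k y z) * (g x z - q).
set D3 := \sum_(y in Y) \sum_(z in Z) v y * w z * (k y z - s).
have -> : \sum_(z in Z) \sum_(x in X) \sum_(y in Y)
      u x * v y * w z * (f x y * g x z * k y z) -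
    p * q * s * (\sum_(x in X) u x) * (\sum_(y in Y) v y) * (\sum_(z in Z) w z) =
    D1 + p * D2 + p * q * (\sum_(x in X) u x) * D3.
  have -> : p * q * s * (\sum_(x in X) u x) * (\sum_(y in Y) v y) * (\sum_(z in Z) w z) =
    \sum_(z in Z) \sum_(x in X) \sum_(y in Y) p * q * s * (u x * v y * w z).
    rewrite mulr_sumr; apply: eq_bigr => z _.
    rewrite (_ : _ * w z = (\sum_(x in X) u x) *
      ((\sum_(y in Y) v y) * (p * q * s * w z))); last by ring.
    rewrite mulr_suml; apply: eq_bigr => x _.
    by rewrite mulr_suml mulr_sumr; apply: eq_bigr => y _; ring.
  have -> : p * D2 = \sum_(z in Z) \sum_(x in X) \sum_(y in Y)
      p * (v y * (u x * (w z * k y z) * (g x z - q))).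
    rewrite exchange_big /=; under [RHS]eq_bigr do rewrite exchange_big /=.
    rewrite exchange_big /= /D2 mulr_sumr; apply: eq_bigr => y _.
    rewrite !mulr_sumr; apply: eq_bigr => x _.
    by rewrite !mulr_sumr; apply: eq_bigr => z _.
  have -> : p * q * (\sum_(x in X) u x) * D3 = \sum_(z in Z) \sum_(x in X) \sum_(y in Y)
      p * q * u x * (v y * w z * (k y z - s)).
    rewrite exchange_big /= -mulrA mulr_suml mulr_sumr; apply: eq_bigr => x _.
    rewrite exchange_big /= !mulr_sumr; apply: eq_bigr => y _.
    by rewrite !mulr_sumr; apply: eq_bigr => z _; ring.
  rewrite /D1 -sumrB -!big_split; apply: eq_bigr => z _ /=.
  rewrite mulr_sumr -sumrB -!big_split; apply: eq_bigr => x _ /=.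
  by rewrite mulr_sumr -sumrB -!big_split; apply: eq_bigr => y _ /=; ring.
have sum1 (I : finType) (A : {set I}) (F G : I -> R) (e : R) :
    (forall i, `|F i| <= 1) -> (forall i, `|G i| <= e) -> 0 <= e ->
    `|\sum_(i in A) F i * G i| <= #|A|%:R * e.
  move=> F1 Ge e0; apply: le_trans (ler_norm_sum _ _ _) _.
  rewrite mulrC mulr_natr -sumr_const; apply: ler_sum => i _.
  by rewrite normrM -[e]mul1r ler_pM.
have D1le : `|D1| <= d * #|X|%:R * #|Y|%:R * #|Z|%:R.
  rewrite [leRHS]mulrC; apply: sum1 => // [z|]; last by rewrite !mulr_ge0.
  by apply: cycle4_discrepancy => // i; rewrite normrM mulr_ile1.
have D2le : `|D2| <= d * #|X|%:R * #|Y|%:R * #|Z|%:R.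
  rewrite [leRHS](_ : _ = #|Y|%:R * (d * #|X|%:R * #|Z|%:R)); last by ring.
  apply: sum1 => // [y|]; last by rewrite !mulr_ge0.
  by apply: cycle4_discrepancy => // i; rewrite normrM mulr_ile1.
have D3le : `|D3| <= d * #|Y|%:R * #|Z|%:R by exact: cycle4_discrepancy.
have ule : `|\sum_(x in X) u x| <= #|X|%:R.
  under eq_bigr do rewrite -[u _]mulr1.
  by rewrite -[leRHS]mulr1; apply: sum1 => // x; rewrite normr1.
have D2' : `|p * D2| <= d * #|X|%:R * #|Y|%:R * #|Z|%:R.
  by rewrite normrM (le_trans _ D2le) // ler_piMl.
have D3' : `|p * q * (\sum_(x in X) u x) * D3| <= d * #|X|%:R * #|Y|%:R * #|Z|%:R.
  rewrite [leRHS](_ : _ = #|X|%:R * (d * #|Y|%:R * #|Z|%:R)); last by ring.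
  rewrite normrM ler_pM // normrM (le_trans _ ule) // ler_piMl //.
  by rewrite normrM mulr_ile1.
rewrite (_ : 3 * d * _ * _ * _ = d * #|X|%:R * #|Y|%:R * #|Z|%:R +
  d * #|X|%:R * #|Y|%:R * #|Z|%:R + d * #|X|%:R * #|Y|%:R * #|Z|%:R); last by ring.
apply: le_trans (ler_normD _ _) _; apply: lerD => //.
by apply: le_trans (ler_normD _ _) _; apply: lerD.
Qed.

(** For 0/1 weights this is the number of copies of [K_{2,2,2}], degenerate ones included; the
    square ranges over the two vertices in [Z]. *)
Definition octahedra : R :=
  \sum_(x0 in X) \sum_(x1 in X) \sum_(y0 in Y) \sum_(y1 in Y)
    f x0 y0 * f x0 y1 * f x1 y0 * f x1 y1 *
    (\sum_(z in Z) g x0 z * g x1 z * k y0 z * k y1 z) ^+ 2.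

(** Each Cauchy-Schwarz step doubles one vertex class: [t2] doubles [y] over the edges [xz], [t3]
    doubles [x] over the pairs of edges [y0 z], [y1 z], and [octahedra] doubles [z] over the
    four-cycles of [f]. The number [ch] of pairs of edges at a vertex [z] is in turn bounded by the
    four-cycles of [k]. *)
Lemma triangle_octahedra :
  (forall x y, f x y ^+ 2 = f x y) -> (forall x z, g x z ^+ 2 = g x z) ->
  (forall y z, k y z ^+ 2 = k y z) ->
  (\sum_(z in Z) \sum_(x in X) \sum_(y in Y) f x y * g x z * k y z) ^+ 8 <=
  (\sum_(z in Z) \sum_(x in X) g x z) ^+ 4 *
  (#|Y|%:R ^+ 2 * cycle4 Y Z k) * cycle4 X Y f * octahedra.
Proof.
move=> ff gg kk.
have f0 x y : 0 <= f x y by rewrite -ff sqr_ge0.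
have g0 x z : 0 <= g x z by rewrite -gg sqr_ge0.
have k0 y z : 0 <= k y z by rewrite -kk sqr_ge0.
set t := \sum_(z in Z) _; set eg := \sum_(z in Z) \sum_(x in X) g x z.
pose t2 := \sum_(z in Z) \sum_(x in X) \sum_(y0 in Y) \sum_(y1 in Y)
  g x z * (f x y0 * k y0 z) * (f x y1 * k y1 z).
pose ch := \sum_(z in Z) \sum_(y0 in Y) \sum_(y1 in Y) k y0 z * k y1 z.
pose t3 := \sum_(z in Z) \sum_(y0 in Y) \sum_(y1 in Y) \sum_(x0 in X) \sum_(x1 in X)
  k y0 z * k y1 z * (g x0 z * f x0 y0 * f x0 y1) * (g x1 z * f x1 y0 * f x1 y1).
have tt2 : t ^+ 2 <= eg * t2.
  apply: sqr_sum_le => z _; [by do ?[apply: sumr_ge0 => ? _]; rewrite ?(sqr_ge0, mulr_ge0)|by do ?[apply: sumr_ge0 => ? _]; rewrite ?(sqr_ge0, mulr_ge0)|].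
  apply: sqr_sum_le => x _; [by do ?[apply: sumr_ge0 => ? _]; rewrite ?(sqr_ge0, mulr_ge0)|by do ?[apply: sumr_ge0 => ? _]; rewrite ?(sqr_ge0, mulr_ge0)|].
  rewrite sqr_sum_expand mulr_sumr; apply: ler_sum => y0 _; rewrite mulr_sumr.
  apply: ler_sum => y1 _; rewrite le_eqVlt; apply/orP; left; apply/eqP; ring.
have t2t3 : t2 ^+ 2 <= ch * t3.
  rewrite (_ : t2 = \sum_(z in Z) \sum_(y0 in Y) \sum_(y1 in Y)
    k y0 z * k y1 z * \sum_(x in X) g x z * f x y0 * f x y1); last first.
    apply: eq_bigr => z _; rewrite exchange_big; apply: eq_bigr => y0 _ /=.
    rewrite exchange_big; apply: eq_bigr => y1 _ /=.
    by rewrite mulr_sumr; apply: eq_bigr => x _; ring.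
  apply: sqr_sum_le => z _; [by do ?[apply: sumr_ge0 => ? _]; rewrite ?(sqr_ge0, mulr_ge0)|by do ?[apply: sumr_ge0 => ? _]; rewrite ?(sqr_ge0, mulr_ge0)|].
  apply: sqr_sum_le => y0 _; [by do ?[apply: sumr_ge0 => ? _]; rewrite ?(sqr_ge0, mulr_ge0)|by do ?[apply: sumr_ge0 => ? _]; rewrite ?(sqr_ge0, mulr_ge0)|].
  apply: sqr_sum_le => y1 _; [by do ?[apply: sumr_ge0 => ? _]; rewrite ?(sqr_ge0, mulr_ge0)|by do ?[apply: sumr_ge0 => ? _]; rewrite ?(sqr_ge0, mulr_ge0)|].
  rewrite exprMn sqr_sum_expand !mulr_sumr; apply: ler_sum => x0 _; rewrite !mulr_sumr.
  apply: ler_sum => x1 _.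
  rewrite le_eqVlt; apply/orP; left; apply/eqP; ring.
have t3o : t3 ^+ 2 <= cycle4 X Y f * octahedra.
  rewrite (_ : t3 = \sum_(x0 in X) \sum_(x1 in X) \sum_(y0 in Y) \sum_(y1 in Y)
    f x0 y0 * f x0 y1 * f x1 y0 * f x1 y1 *
    (\sum_(z in Z) g x0 z * g x1 z * k y0 z * k y1 z)); last first.
    rewrite /t3 exchange_big /=; under eq_bigr do rewrite exchange_big /=.
    under eq_bigr => y0 _ do under eq_bigr => y1 _ do
      (rewrite exchange_big /=; under eq_bigr => x0 _ do rewrite exchange_big /=).
    under eq_bigr => y0 _ do
      (rewrite exchange_big /=; under eq_bigr => x0 _ do rewrite exchange_big /=).
    rewrite exchange_big; apply: eq_bigr => x0 _ /=.
    rewrite exchange_big; apply: eq_bigr => x1 _ /=.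
    apply: eq_bigr => y0 _; apply: eq_bigr => y1 _.
    by rewrite mulr_sumr; apply: eq_bigr => z _; ring.
  apply: sqr_sum_le => x0 _; [by do ?[apply: sumr_ge0 => ? _]; rewrite ?(sqr_ge0, mulr_ge0)|by do ?[apply: sumr_ge0 => ? _]; rewrite ?(sqr_ge0, mulr_ge0)|].
  apply: sqr_sum_le => x1 _; [by do ?[apply: sumr_ge0 => ? _]; rewrite ?(sqr_ge0, mulr_ge0)|by do ?[apply: sumr_ge0 => ? _]; rewrite ?(sqr_ge0, mulr_ge0)|].
  apply: sqr_sum_le => y0 _; [by do ?[apply: sumr_ge0 => ? _]; rewrite ?(sqr_ge0, mulr_ge0)|by do ?[apply: sumr_ge0 => ? _]; rewrite ?(sqr_ge0, mulr_ge0)|].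
  apply: sqr_sum_le => y1 _; [by do ?[apply: sumr_ge0 => ? _]; rewrite ?(sqr_ge0, mulr_ge0)|by do ?[apply: sumr_ge0 => ? _]; rewrite ?(sqr_ge0, mulr_ge0)|].
  by rewrite exprMn mulrA expr2.
have chE : ch = \sum_(z in Z) (\sum_(y in Y) 1 * k y z) ^+ 2.
  apply: eq_bigr => z _; under [in RHS]eq_bigr do rewrite mul1r.
  by rewrite sqr_sum_expand.
have ch2 : ch ^+ 2 <= #|Y|%:R ^+ 2 * cycle4 Y Z k.
  (* Passing through both codegree formulas transposes [cycle4], so that [wdeg_sqr_le] applies to
     the degrees of the vertices of [Z]. *)
  rewrite cycle4_codegr -(cycle4_codegl Z Y (fun z y => k y z)) chE.
  by apply: wdeg_sqr_le => y; rewrite normr1.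
have eg0 : 0 <= eg by do 2!(apply: sumr_ge0 => ? _).
have ch0 : 0 <= ch by do 3!(apply: sumr_ge0 => ? _); rewrite mulr_ge0.
have t20 : 0 <= t2 by do 4!(apply: sumr_ge0 => ? _); rewrite !mulr_ge0.
have t30 : 0 <= t3 by do 5!(apply: sumr_ge0 => ? _); rewrite !mulr_ge0.
have t4E : t ^+ 4 = (t ^+ 2) ^+ 2 by rewrite -exprM.
have t8E : t ^+ 8 = (t ^+ 4) ^+ 2 by rewrite -exprM.
have t4 : t ^+ 4 <= eg ^+ 2 * (ch * t3).
  rewrite t4E; apply: (@le_trans _ _ ((eg * t2) ^+ 2)).
    by rewrite lerXn2r // ?nnegrE ?sqr_ge0 ?mulr_ge0.
  by rewrite exprMn ler_wpM2l // sqr_ge0.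
rewrite t8E; apply: (@le_trans _ _ ((eg ^+ 2 * (ch * t3)) ^+ 2)).
  by apply: lerXn2r => //; rewrite nnegrE ?t4E ?(sqr_ge0, mulr_ge0).
have -> : (eg ^+ 2 * (ch * t3)) ^+ 2 = eg ^+ 4 * ch ^+ 2 * t3 ^+ 2 by ring.
rewrite -[leRHS]mulrA; apply: ler_pM => //; rewrite ?sqr_ge0 //.
  by rewrite mulr_ge0 ?sqr_ge0 ?exprn_ge0.
by rewrite ler_wpM2l ?exprn_ge0.
Qed.

End Tripartite.

(** * The sign matrix of set membership *)

Section Membership.
Variables (R : realFieldType) (m : nat).

Definition msign (a : 'I_m) (b : {set 'I_m}) : R := if a \in b then 1 else -1.

(** For distinct [a] and [a'], toggling [a] in [b] is an involution on sets that changes the sign of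
    every term, so the sum equals its own negative. *)
Lemma msign_orthogonal a a' : 
  \sum_b msign a b * msign a' b = if a == a' then 2 ^+ m else 0.
Proof.
case: eqVneq => [<-|neq].
  rewrite (eq_bigr (fun=> 1)) => [|b _]; last by rewrite /msign; case: ifP => _; ring.
  by rewrite sumr_const -cardsT -finset.powersetT card_powerset cardsT card_ord natrX.
pose flip (b : {set 'I_m}) := if a \in b then b :\ a else a |: b.
have flipK : involutive flip.
  move=> b; rewrite /flip; case: (boolP (a \in b)) => ab.
    by rewrite finset.setD11 finset.setD1K.
  by rewrite finset.setU11 finset.setU1K.
set s := \sum_b _; suff : s = - s by lra.
rewrite {1}/s (reindex_inj (inv_inj flipK)) -sumrN; apply: eq_bigr => b _ /=.
rewrite /msign /flip; case: (boolP (a \in b)) => ab.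
  by rewrite finset.setD11 finset.in_setD1 eq_sym neq /= mulN1r mul1r.
by rewrite finset.setU11 finset.in_setU1 eq_sym (negbTE neq) /= mulN1r mul1r opprK.
Qed.

(** Lindsey's lemma: Cauchy-Schwarz over [b], after which the orthogonality of the rows leaves only
    the diagonal terms. *)
Lemma msign_form_le (u : 'I_m -> R) (v : {set 'I_m} -> R) :
  (\sum_a \sum_b msign a b * u a * v b) ^+ 2 <=
  2 ^+ m * (\sum_a u a ^+ 2) * (\sum_b v b ^+ 2).
Proof.
rewrite exchange_big /=.
apply: (@le_trans _ _ ((\sum_b (\sum_a msign a b * u a) ^+ 2) * \sum_b v b ^+ 2)).
  apply: sqr_sum_le => b _; rewrite ?sqr_ge0 // -exprMn mulr_suml lexx //.
rewrite ler_wpM2r ?sumr_ge0 // => [b _|]; first exact: sqr_ge0.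
rewrite (eq_bigr (fun b => \sum_a \sum_a' (msign a b * u a) * (msign a' b * u a')));
  last by move=> b _; exact: sqr_sum_expand.
rewrite exchange_big /= mulr_sumr; apply: ler_sum => a _.
rewrite exchange_big /=.
under eq_bigr => a' _ do (under eq_bigr do rewrite mulrACA; rewrite -mulr_suml msign_orthogonal).
rewrite (bigD1 a) //= eqxx big1 ?addr0 ?expr2 // => a' /negbTE.
by rewrite eq_sym => ->; rewrite mul0r.
Qed.

(** The indicator of a membership value is half of [1 + msign] or [1 - msign], so the sum is half of
    [U * V + D] or [U * V - D]. The caps on the block weights turn [msign_form_le] into
    [m * D^2 <= n^2 * U * V], and the last hypothesis makes this at most [m * (U * V / 2)^2]. *)
Lemma membership_balanced (n : R) (u : 'I_m -> R) (v : {set 'I_m} -> R) (c : bool) :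
  (0 < m)%N -> (forall a, 0 <= u a) -> (forall b, 0 <= v b) ->
  (forall a, u a * m%:R <= n) -> (forall b, v b * 2 ^+ m <= n) ->
  4 * n ^+ 2 <= m%:R * (\sum_a u a) * (\sum_b v b) ->
  (\sum_a u a) * (\sum_b v b) / 4 <=
  \sum_(a : 'I_m) \sum_(b : {set 'I_m}) ((a \in b) == c)%:R * (u a * v b).
Proof.
move=> m0 u0 v0 un vn; set U := \sum_a u a; set V := \sum_b v b => big.
set D := \sum_a \sum_b msign a b * u a * v b.
have mR : 0 < m%:R :> R by rewrite ltr0n.
have U0 : 0 <= U by exact: sumr_ge0.
have V0 : 0 <= V by exact: sumr_ge0.
have n0 : 0 <= n by rewrite (le_trans _ (vn finset.set0)) // mulr_ge0 ?exprn_ge0.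
have u2 : m%:R * (\sum_a u a ^+ 2) <= n * U.
  rewrite !mulr_sumr; apply: ler_sum => a _.
  by rewrite expr2 mulrA ler_wpM2r // mulrC.
have v2 : 2 ^+ m * (\sum_b v b ^+ 2) <= n * V.
  rewrite !mulr_sumr; apply: ler_sum => b _.
  by rewrite expr2 mulrA ler_wpM2r // mulrC.
have D2 : m%:R * D ^+ 2 <= n ^+ 2 * U * V.
  apply: (@le_trans _ _ ((m%:R * \sum_a u a ^+ 2) * (2 ^+ m * \sum_b v b ^+ 2))).
    rewrite -mulrA ler_wpM2l // mulrCA mulrA; exact: msign_form_le.
  rewrite (_ : n ^+ 2 * U * V = (n * U) * (n * V)); last by ring.
  by apply: ler_pM => //; rewrite mulr_ge0 ?exprn_ge0 ?sumr_ge0 // => ? _; rewrite sqr_ge0.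
have Dle : `|D| <= U * V / 2.
  rewrite -(@ler_pXn2r _ 2) ?nnegrE ?divr_ge0 ?mulr_ge0 //.
  rewrite -normrX ger0_norm ?sqr_ge0 // -(ler_pM2l mR) (le_trans D2) //.
  rewrite (_ : m%:R * (U * V / 2) ^+ 2 = (m%:R * U * V) / 4 * (U * V)); last by field.
  rewrite -(mulrA (n ^+ 2)) ler_wpM2r ?mulr_ge0 // ler_pdivlMr //; lra.
have -> : \sum_(a : 'I_m) \sum_(b : {set 'I_m}) ((a \in b) == c)%:R * (u a * v b) =
    (U * V + (if c then D else - D)) / 2.
  have -> : (if c then D else - D) = \sum_a \sum_b (if c then 1 else -1) * (msign a b * u a * v b).
    under [RHS]eq_bigr do rewrite -mulr_sumr.
    by rewrite -mulr_sumr; case: (c); rewrite ?mul1r ?mulN1r.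
  rewrite /U /V big_distrlr -big_split mulr_suml /=; apply: eq_bigr => a _.
  rewrite -big_split mulr_suml /=; apply: eq_bigr => b _.
  by rewrite /msign; case: (c); case: (a \in b) => /=; field.
move: Dle; rewrite ler_norml => /andP[].
move: (U * V) (D) => x y; case: (c); lra.
Qed.

End Membership.

(** * Octahedral sums and their monotonicity *)

Section Octahedron.
Variables (R : realFieldType).

(** This is the octahedral sum of [dev23] with the two vertices of [Z] collected into a square,
    which makes every summand nonnegative whatever the signs of [h]. *)
Definition octahedron (S T U : finType) (X : {set S}) (Y : {set T}) (Z : {set U})
    (h : S -> T -> U -> R) : R :=
  \sum_(x0 in X) \sum_(x1 in X) \sum_(y0 in Y) \sum_(y1 in Y)
    (\sum_(z in Z) h x0 y0 z * h x0 y1 z * h x1 y0 z * h x1 y1 z) ^+ 2.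

(** The definition singles out [Z] inside the square. Rotating the classes puts [Z] outside, where
    [octahedron_subl] can restrict it too. *)
Lemma octahedron_rot (S T U : finType) (X : {set S}) (Y : {set T}) (Z : {set U})
    (h : S -> T -> U -> R) :
  octahedron X Y Z h = octahedron Z X Y (fun z x y => h x y z).
Proof.
rewrite /octahedron; transitivity
  (\sum_(x0 in X) \sum_(x1 in X) \sum_(y0 in Y) \sum_(y1 in Y) \sum_(z0 in Z) \sum_(z1 in Z)
    (h x0 y0 z0 * h x0 y1 z0 * h x1 y0 z0 * h x1 y1 z0) *
    (h x0 y0 z1 * h x0 y1 z1 * h x1 y0 z1 * h x1 y1 z1)).
  do 4![apply: eq_bigr => ? _]; exact: sqr_sum_expand.
under eq_bigr => x0 _ do under eq_bigr => x1 _ do under eq_bigr => y0 _ do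
  rewrite exchange_big /=.
under eq_bigr => x0 _ do under eq_bigr => x1 _ do rewrite exchange_big /=.
under eq_bigr => x0 _ do rewrite exchange_big /=.
rewrite exchange_big /=; apply: eq_bigr => z0 _.
under eq_bigr => x0 _ do under eq_bigr => x1 _ do under eq_bigr => y0 _ do
  rewrite exchange_big /=.
under eq_bigr => x0 _ do under eq_bigr => x1 _ do rewrite exchange_big /=.
under eq_bigr => x0 _ do rewrite exchange_big /=.
rewrite exchange_big /=; apply: eq_bigr => z1 _.
do 2![apply: eq_bigr => ? _]; rewrite sqr_sum_expand.
by do 2![apply: eq_bigr => ? _]; ring.
Qed.

Lemma ler_sum_sub (I : finType) (A B : {set I}) (F G : I -> R) : A \subset B ->
  (forall i, F i <= G i) -> (forall i, 0 <= G i) ->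
  \sum_(i in A) F i <= \sum_(i in B) G i.
Proof.
move=> AB FG G0; apply: (@le_trans _ _ (\sum_(i in A) G i)); first exact: ler_sum.
by rewrite [leRHS](big_setID A) /= (finset.setIidPr AB) lerDl; exact: sumr_ge0.
Qed.

Lemma octahedron_subl (S T U : finType) (X X' : {set S}) (Y Y' : {set T}) (Z : {set U})
    (h : S -> T -> U -> R) : X' \subset X -> Y' \subset Y ->
  octahedron X' Y' Z h <= octahedron X Y Z h.
Proof.
move=> sX sY.
apply: ler_sum_sub => // x0; last by do 3![apply: sumr_ge0 => ? _]; exact: sqr_ge0.
apply: ler_sum_sub => // x1; last by do 2![apply: sumr_ge0 => ? _]; exact: sqr_ge0.
apply: ler_sum_sub => // y0; last by apply: sumr_ge0 => ? _; exact: sqr_ge0.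
by apply: ler_sum_sub => // y1; exact: sqr_ge0.
Qed.

Lemma octahedron_sub (S T U : finType) (X X' : {set S}) (Y Y' : {set T}) (Z Z' : {set U})
    (h : S -> T -> U -> R) : X' \subset X -> Y' \subset Y -> Z' \subset Z ->
  octahedron X' Y' Z' h <= octahedron X Y Z h.
Proof.
move=> sX sY sZ; apply: (@le_trans _ _ (octahedron X' Y' Z h)).
  by rewrite (octahedron_rot X' Y' Z') (octahedron_rot X' Y' Z); exact: octahedron_subl.
exact: octahedron_subl.
Qed.

Lemma cycle4_sub (S T : finType) (X X' : {set S}) (Y Y' : {set T}) (f f' : S -> T -> R) :
  X' \subset X -> Y' \subset Y -> (forall x y, 0 <= f' x y <= f x y) ->
  cycle4 X' Y' f' <= cycle4 X Y f.
Proof.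
move=> sX sY ff.
have f'0 x y : 0 <= f' x y by have /andP[] := ff x y.
have f'f x y : f' x y <= f x y by have /andP[] := ff x y.
have f0 x y : 0 <= f x y by exact: le_trans (f'f x y).
apply: ler_sum_sub => // x0; last by do 3![apply: sumr_ge0 => ? _]; rewrite !mulr_ge0.
apply: ler_sum_sub => // x1; last by do 2![apply: sumr_ge0 => ? _]; rewrite !mulr_ge0.
apply: ler_sum_sub => // y0; last by apply: sumr_ge0 => ? _; rewrite !mulr_ge0.
apply: ler_sum_sub => // y1; last by rewrite !mulr_ge0.
by rewrite !ler_pM ?mulr_ge0.
Qed.

End Octahedron.

(** * Quasirandom triads *)

Section Bigraph.
Variables (R : realType) (V : finType) (B : bigraph V).

Definition bind (x y : V) : R := ((x, y) \in bE B)%:R.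

Lemma bdevE x y : bdev R B x y = bind x y - bdensity R B.
Proof. by rewrite /bdev /bind; case: ifP => _; rewrite ?sub0r. Qed.

Lemma card_bE_le : (#|bE B| <= #|bU B| * #|bW B|)%N.
Proof. by rewrite -cardsX; exact/subset_leq_card/bE_sub. Qed.

Lemma bdensity_le1 : bdensity R B <= 1.
Proof.
rewrite /bdensity -natrM; have := card_bE_le; set N := (_ * _)%N => le.
have [->|N0] := eqVneq N 0%N; first by rewrite invr0 mulr0.
by rewrite ler_pdivrMr ?ltr0n ?lt0n // mul1r ler_nat.
Qed.

Lemma bdensity_card : #|bE B|%:R = bdensity R B * (#|bU B|%:R * #|bW B|%:R).
Proof.
rewrite /bdensity -natrM; have := card_bE_le; set N := (_ * _)%N => le.
(* If one side is empty, the density is 0 by convention and [card_bE_le] leaves no edges, so the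
   identity still holds. *)
have [N0|N0] := eqVneq N 0%N.
  by move: le; rewrite N0 leqn0 => /eqP ->; rewrite mulr0.
by rewrite mulfVK // pnatr_eq0.
Qed.

Lemma dev2_cycle4 eps d : dev2 B eps d ->
  cycle4 (bU B) (bW B) (fun x y => bind x y - bdensity R B) <=
  eps * #|bU B|%:R ^+ 2 * #|bW B|%:R ^+ 2.
Proof.
case=> _; apply: le_trans; rewrite le_eqVlt; apply/orP; left; apply/eqP.
do 4![apply: eq_bigr => ? _]; rewrite !big_bool /= -!bdevE; ring.
Qed.

Lemma sum_bind_le (X Y : {set V}) :
  \sum_(y in Y) \sum_(x in X) bind x y <= #|bE B|%:R.
Proof.
rewrite exchange_big /= pair_big_dep /= -sum1_card natr_sum [leRHS]big_mkcond /=.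
rewrite big_mkcond /=; apply: ler_sum => -[x y] _ /=.
by rewrite /bind; case: ifP => _; case: ifP.
Qed.

End Bigraph.

Section Triad.
Variables (R : realType) (H : graph3) (G : triad H).
Variables (A B C : {set H}) (m : nat) (ia : H -> 'I_m) (ib : H -> {set 'I_m}).
Variables (n kappa lambda d eps : R).
Hypothesis m0 : (0 < m)%N.
Hypothesis oedgesE : forall x y z, x \in A -> y \in B -> z \in C ->
  ((x, y, z) \in oedges H) = (ia x \in ib y).
Hypothesis card_ia : forall a, #|[set x in A | ia x == a]|%:R * m%:R <= n.
Hypothesis card_ib : forall b, #|[set y in B | ib y == b]|%:R * 2 ^+ m <= n.
Hypothesis kappa0 : 0 < kappa.
Hypothesis XA : kappa * #|tX G|%:R <= #|tX G :&: A|%:R.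
Hypothesis YB : kappa * #|tY G|%:R <= #|tY G :&: B|%:R.
Hypothesis ZC : kappa * #|tZ G|%:R <= #|tZ G :&: C|%:R.
Hypothesis XYbig : 4 * n ^+ 2 <= m%:R * #|tX G :&: A|%:R * #|tY G :&: B|%:R.
Hypothesis lambda0 : 0 < lambda.
Hypothesis lambda_XY : lambda <= bdensity R (triad_bXY G).
Hypothesis lambda_XZ : lambda <= bdensity R (triad_bXZ G).
Hypothesis lambda_YZ : lambda <= bdensity R (triad_bYZ G).
Hypothesis d0 : 0 < d.
Hypothesis d_lambda : d <= lambda.
Hypothesis d_small : 3 * (m%:R * 2 ^+ m) * d <= kappa ^+ 3 / 8 * lambda ^+ 3.
Hypothesis eps0 : 0 < eps.
Hypothesis eps_small : eps * 2 ^+ 28 < (kappa ^+ 3 / 8) ^+ 8.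

Notation p := (bdensity R (triad_bXY G)).
Notation q := (bdensity R (triad_bXZ G)).
Notation s := (bdensity R (triad_bYZ G)).
Notation P := (bind R (triad_bXY G)).
Notation Q := (bind R (triad_bXZ G)).
Notation S := (bind R (triad_bYZ G)).
Notation a := (#|tX G|%:R : R).
Notation b := (#|tY G|%:R : R).
Notation c := (#|tZ G|%:R : R).
Notation X' := (tX G :&: A).
Notation Y' := (tY G :&: B).
Notation Z' := (tZ G :&: C).

(** On [A] and [B], [Pc true] collects the pairs of [P] that form edges of [H] with every vertex of
    [C], and [Pc false] those that form none. *)
Let Pc (col : bool) (x y : H) : R :=
  (((x, y) \in tXY G) && ((ia x \in ib y) == col))%:R.

Let p0 : 0 < p. Proof. exact: lt_le_trans lambda_XY. Qed.
Let q0 : 0 < q. Proof. exact: lt_le_trans lambda_XZ. Qed.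
Let s0 : 0 < s. Proof. exact: lt_le_trans lambda_YZ. Qed.

(** An empty side would force density 0 through [x / 0 = 0], against [lambda_XY]. *)
Let ab0 : 0 < a /\ 0 < b.
Proof.
move: p0; rewrite /bdensity /=; case: (#|tX G|) => [|k]; first by rewrite mul0r invr0 mulr0 ltxx.
case: (#|tY G|) => [|l]; first by rewrite mulr0 invr0 mulr0 ltxx.
by rewrite !ltr0n.
Qed.

Let c0 : 0 < c.
Proof.
move: q0; rewrite /bdensity /=; case: (#|tZ G|) => [|k]; first by rewrite mulr0 invr0 mulr0 ltxx.
by rewrite !ltr0n.
Qed.

Lemma sum_indicator (T : finType) (E F : {set T}) (Pr : pred T) :
  \sum_(x in E) ((x \in F) && Pr x)%:R = #|[set x in E :&: F | Pr x]|%:R :> R.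
Proof.
rewrite -sum1_card natr_sum big_mkcond [RHS]big_mkcond /=; apply: eq_bigr => x _.
by rewrite !inE; case: (x \in E); case: (x \in F); case: (Pr x).
Qed.

Lemma card_partition (T I : finType) (E : {set T}) (i : T -> I) :
  \sum_(j : I) #|[set x in E | i x == j]|%:R = #|E|%:R :> R.
Proof.
rewrite -natr_sum -[in RHS]sum1_card (partition_big i xpredT) //=; congr _%:R.
apply: eq_bigr => j _; rewrite -sum1_card; apply: eq_bigl => x; by rewrite !inE.
Qed.

(** The triangles are counted separately over each pair of blocks [(i, j)] whose membership value is
    [col]. The main terms add up, by [membership_balanced], to at least [kappa ^+ 3 / 4] of the
    expected count, and the errors of all [m * 2 ^ m] block pairs cost at most half of that by
    [d_small]. *)
Lemma triangles_ge (col : bool) :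
  cycle4 (tX G) (tY G) (fun x y => P x y - p) <= d ^+ 4 * a ^+ 2 * b ^+ 2 ->
  cycle4 (tX G) (tZ G) (fun x y => Q x y - q) <= d ^+ 4 * a ^+ 2 * c ^+ 2 ->
  cycle4 (tY G) (tZ G) (fun x y => S x y - s) <= d ^+ 4 * b ^+ 2 * c ^+ 2 ->
  kappa ^+ 3 / 8 * (p * q * s * (a * b * c)) <=
  \sum_(z in Z') \sum_(x in X') \sum_(y in Y') Pc col x y * Q x z * S y z.
Proof.
move=> cP cQ cS.
pose u (i : 'I_m) x : R := ((x \in A) && (ia x == i))%:R.
pose v (j : {set 'I_m}) y : R := ((y \in B) && (ib y == j))%:R.
pose w z : R := ((z \in C) && true)%:R.
have [a0 b0] := ab0.
have -> : \sum_(z in Z') \sum_(x in X') \sum_(y in Y') Pc col x y * Q x z * S y z =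
  \sum_(ij : 'I_m * {set 'I_m}) ((ij.1 \in ij.2) == col)%:R *
  \sum_(z in tZ G) \sum_(x in tX G) \sum_(y in tY G)
    u ij.1 x * v ij.2 y * w z * (P x y * Q x z * S y z).
  have big1' (T : finType) (E F : {set T}) (g : T -> R) :
    \sum_(x in E :&: F) g x = \sum_(x in E) (x \in F)%:R * g x.
    rewrite big_mkcond [RHS]big_mkcond /=; apply: eq_bigr => x _.
    by rewrite inE; case: (x \in E); case: (x \in F); rewrite /= ?mul0r ?mul1r.
  under [RHS]eq_bigr do rewrite mulr_sumr.
  rewrite big1' exchange_big /=; apply: eq_bigr => z _.
  under [RHS]eq_bigr do rewrite mulr_sumr.
  rewrite big1' mulr_sumr exchange_big /=; apply: eq_bigr => x _.
  under [RHS]eq_bigr do rewrite mulr_sumr.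
  rewrite big1' !mulr_sumr exchange_big /=; apply: eq_bigr => y _.
  rewrite (bigD1 (ia x, ib y)) //= big1 ?addr0 => [|[i j]].
    rewrite /u /v /w /Pc /bind /= !eqxx !andbT.
    case: ((x, y) \in tXY G); case: (_ == col); rewrite /= ?(mul0r, mulr0, mul1r, mulr1) //; ring.
  rewrite xpair_eqE negb_and => /orP[] /negbTE h; rewrite /u /v /= (eq_sym (ia x)) (eq_sym (ib y)) h andbF /=;
    by rewrite !(mulr0, mul0r).
have count i j : p * q * s * (#|[set x in X' | ia x == i]|%:R *
     #|[set y in Y' | ib y == j]|%:R) * #|Z'|%:R - 3 * d * a * b * c <=
   \sum_(z in tZ G) \sum_(x in tX G) \sum_(y in tY G)
    u i x * v j y * w z * (P x y * Q x z * S y z).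
  have n1 (t : bool) : `|t%:R| <= 1 :> R by case: t; rewrite ?normr0 ?normr1.
  have b1 B0 : 0 < bdensity R B0 -> `|bdensity R B0| <= 1.
    by move=> ?; rewrite gtr0_norm // bdensity_le1.
  have := @triangle_count R _ _ _ (tX G) (tY G) (tZ G) P Q S p q s d (u i) (v j) w
    (fun=> n1 _) (fun=> n1 _) (fun=> n1 _) (fun _ _ => n1 _) (fun _ _ => n1 _)
    (b1 _ _ p0) (b1 _ _ q0) (ltW d0) cP cQ cS.
  rewrite !sum_indicator.
  rewrite (_ : [set x in Z' | true] = Z'); last by apply/setP => x; rewrite !inE andbT.
  rewrite ler_distl => /andP[+ _]; apply: le_trans.
  by rewrite le_eqVlt; apply/orP; left; apply/eqP; ring.
(* The error is charged to every block pair, also to those of the other colour, where the term is 0;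
   the error sum then has no condition on [(i, j)]. *)
apply: le_trans (_ : \sum_(ij : 'I_m * {set 'I_m})
    (((ij.1 \in ij.2) == col)%:R * (#|[set x in X' | ia x == ij.1]|%:R *
     #|[set y in Y' | ib y == ij.2]|%:R) * (p * q * s * #|Z'|%:R) - 3 * d * a * b * c) <= _); last first.
  apply: ler_sum => -[i j] _ /=; case: (_ == col); rewrite /= ?mul1r ?mul0r.
    by apply: le_trans (count i j); rewrite le_eqVlt; apply/orP; left; apply/eqP; ring.
  by rewrite sub0r oppr_le0 !mulr_ge0 // ltW.
rewrite sumrB sumr_const card_prod card_ord -cardsT -powersetT card_powerset cardsT card_ord.
rewrite -mulr_suml -(pair_big xpredT xpredT (fun (i : 'I_m) (j : {set 'I_m}) => ((i \in j) == col)%:R *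
  (#|[set x in X' | ia x == i]|%:R * #|[set y in Y' | ib y == j]|%:R))) /=.
set D := \sum_i _.
have DXY : #|X'|%:R * #|Y'|%:R / 4 <= D.
  rewrite -(card_partition X' ia) -(card_partition Y' ib).
  apply: (@membership_balanced R m n) => // [i|j|].
  - apply: le_trans (card_ia i); rewrite ler_wpM2r // ler_nat subset_leq_card //.
    by apply/fintype.subsetP => x; rewrite !inE => /andP[/andP[_ ->] ->].
  - apply: le_trans (card_ib j); rewrite ler_wpM2r ?exprn_ge0 // ler_nat subset_leq_card //.
    by apply/fintype.subsetP => x; rewrite !inE => /andP[/andP[_ ->] ->].
  - by rewrite !card_partition.
have DXY' : kappa ^+ 2 / 4 * (a * b) <= D.
  apply: le_trans DXY; rewrite (_ : kappa ^+ 2 / 4 * (a * b) = (kappa * a) * (kappa * b) / 4); last by field.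
  by rewrite ler_wpM2r ?invr_ge0 // ler_pM ?mulr_ge0 // ltW.
have main : kappa ^+ 3 / 4 * (p * q * s * (a * b * c)) <= D * (p * q * s * #|Z'|%:R).
  rewrite (_ : _ * _ = (kappa ^+ 2 / 4 * (a * b)) * (p * q * s * (kappa * c))); last by ring.
  have pqs0 : 0 <= p * q * s by rewrite !mulr_ge0 // ltW.
  apply: ler_pM => //; rewrite ?ler_wpM2l //.
    by rewrite !mulr_ge0 ?sqr_ge0 ?invr_ge0 // ltW.
  by rewrite !mulr_ge0 // ltW.
have err : (3 * d * a * b * c) *+ (m * 2 ^ m) <= kappa ^+ 3 / 8 * (p * q * s * (a * b * c)).
  rewrite -mulr_natr natrM natrX.
  rewrite (_ : _ * _ = 3 * (m%:R * 2 ^+ m) * d * (a * b * c)); last by ring.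
  have abc : 0 <= a * b * c by rewrite !mulr_ge0 // ltW.
  have lpqs : lambda ^+ 3 <= p * q * s.
    rewrite (_ : lambda ^+ 3 = lambda * lambda * lambda); last by ring.
    have l0 := ltW lambda0.
    by apply: ler_pM => //; [exact: mulr_ge0|exact: ler_pM].
  have k0 : 0 <= kappa ^+ 3 / 8 by rewrite divr_ge0 // exprn_ge0 // ltW.
  rewrite (mulrA (kappa ^+ 3 / 8)); apply: ler_wpM2r => //.
  by apply: (le_trans d_small); exact: ler_wpM2l.
by apply: le_trans (lerB main err); rewrite le_eqVlt; apply/orP; left; apply/eqP; field.
Qed.

Lemma tdevE x y z : x \in X' -> y \in Y' -> z \in Z' ->
  tdev R G x y z = ((ia x \in ib y)%:R - tdensity R G) * P x y * Q x z * S y z.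
Proof.
rewrite !inE => /andP[xX xA] /andP[yY yB] /andP[zZ zC].
rewrite /tdev oedgesE // /bind /= inE /= xX yY zZ /=.
case: ((x, y) \in tXY G); case: ((x, z) \in tXZ G); case: ((y, z) \in tYZ G);
  case: (ia x \in ib y); rewrite /= ?(mulr0, mul0r, mulr1) ?sub0r //.
Qed.

(** On [A], [B], [C] the function [tdev] is a factor [e x y] times indicators of the edges at [z].
    Hence each inner square is a product of four squares [e ^+ 2] and the square of a
    common-neighbourhood count [D]. On the chosen colour class each [e ^+ 2] is at least 1/4, which
    gives the loss of [4 ^+ 4]. *)
Lemma octahedron_tdev_ge : exists col : bool,
  octahedra X' Y' Z' (Pc col) Q S / 4 ^+ 4 <= octahedron (tX G) (tY G) (tZ G) (tdev R G).
Proof.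
set t := tdensity R G.
(* The colour farther from the density is chosen: edges if [t <= 1/2], non-edges otherwise, so that
   the deviation is at least 1/2 in absolute value. *)
pose col := t <= 2^-1; exists col.
have colE x y : Pc col x y / 4 <= ((ia x \in ib y)%:R - t) ^+ 2 * P x y.
  rewrite /Pc /bind /=; case: ((x, y) \in tXY G); rewrite /= ?mulr0 ?mul0r // mulr1.
  rewrite /col; case: (ia x \in ib y); case: (lerP t 2^-1) => /= tle;
    rewrite ?mul0r ?sqr_ge0 //; nra.
have Pc0 x y : 0 <= Pc col x y / 4 by rewrite divr_ge0.
apply: le_trans (octahedron_sub _ (finset.subsetIl _ A) (finset.subsetIl _ B) (finset.subsetIl _ C)).
rewrite /octahedra mulr_suml; apply: ler_sum => x0 x0X.
rewrite mulr_suml; apply: ler_sum => x1 x1X.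
rewrite mulr_suml; apply: ler_sum => y0 y0Y.
rewrite mulr_suml; apply: ler_sum => y1 y1Y.
pose e x y : R := ((ia x \in ib y)%:R - t) * P x y.
have PP x y : P x y ^+ 2 = P x y by rewrite /bind; case: (_ \in _); rewrite ?expr1n ?expr0n.
have QQ x y : Q x y ^+ 2 = Q x y by rewrite /bind; case: (_ \in _); rewrite ?expr1n ?expr0n.
have SS x y : S x y ^+ 2 = S x y by rewrite /bind; case: (_ \in _); rewrite ?expr1n ?expr0n.
set D := \sum_(z in Z') Q x0 z * Q x1 z * S y0 z * S y1 z.
have -> : \sum_(z in Z') tdev R G x0 y0 z * tdev R G x0 y1 z * tdev R G x1 y0 z * tdev R G x1 y1 z
    = e x0 y0 * e x0 y1 * e x1 y0 * e x1 y1 * D.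
  rewrite /D mulr_sumr; apply: eq_bigr => z zZ; rewrite !tdevE // -/t.
  (* Each edge at [z] occurs in two of the four factors, and the indicators are idempotent. *)
  rewrite -[Q x0 z in RHS]QQ -[Q x1 z in RHS]QQ -[S y0 z in RHS]SS -[S y1 z in RHS]SS /e; ring.
have eE x y : Pc col x y / 4 <= e x y ^+ 2 by rewrite /e exprMn PP.
rewrite (_ : _ / 4 ^+ 4 = (Pc col x0 y0 / 4) * (Pc col x0 y1 / 4) *
  (Pc col x1 y0 / 4) * (Pc col x1 y1 / 4) * D ^+ 2); last by field.
rewrite (_ : (_ * D) ^+ 2 = e x0 y0 ^+ 2 * e x0 y1 ^+ 2 * e x1 y0 ^+ 2 * e x1 y1 ^+ 2 * D ^+ 2);
  last by ring.
apply: ler_wpM2r; rewrite ?sqr_ge0 //.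
by apply: ler_pM; rewrite ?mulr_ge0 //; apply: ler_pM; rewrite ?mulr_ge0 //; apply: ler_pM.
Qed.

(** Inserting the triangle bound and the four-cycle bounds into [triangle_octahedra] gives [tau ^+ 8
    * (p * q * s) ^+ 4 * (a * b * c) ^+ 2 <= 2 ^+ 8 * O]. Regularity bounds [O] above by the same
    product with [eps * 2 ^+ 20] in place of [tau ^+ 8]: [2 ^+ 8] is the loss of
    [octahedron_tdev_ge] and [2 ^+ 12] that of replacing the three densities. Together this
    contradicts [eps_small]. *)
Lemma triad_not_dev23 : d <= 1 -> ~ dev23 G eps (d ^+ 4).
Proof.
move=> d1 [dXY [dXZ [dYZ [[dXY0 dXZ0 dYZ0] [devP devQ devS] oct]]]].
have [a0 b0] := ab0.
have cP := dev2_cycle4 devP; have cQ := dev2_cycle4 devQ; have cS := dev2_cycle4 devS.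
have [col octge] := octahedron_tdev_ge.
have T := triangles_ge col cP cQ cS.
set t := \sum_(z in Z') _ in T.
set O := octahedra _ _ _ _ _ _ in octge.
have PcPc x y : Pc col x y ^+ 2 = Pc col x y.
  by rewrite /Pc; case: (_ && _); rewrite ?expr1n ?expr0n.
have bb (B0 : bigraph H) x y : bind R B0 x y ^+ 2 = bind R B0 x y.
  by rewrite /bind; case: (_ \in _); rewrite ?expr1n ?expr0n.
have bind0 (B0 : bigraph H) x y : 0 <= bind R B0 x y by rewrite /bind.
have T8 := triangle_octahedra X' Y' Z' PcPc (bb (triad_bXZ G)) (bb (triad_bYZ G)).
rewrite -/t -/O in T8.
have O0 : 0 <= O.
  by do 4![apply: sumr_ge0 => ? _]; rewrite !(sqr_ge0, mulr_ge0) ?bind0 // /Pc.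
have e0 : 0 <= \sum_(z in Z') \sum_(x in X') Q x z.
  by do 2![apply: sumr_ge0 => ? _].
have eQ : \sum_(z in Z') \sum_(x in X') Q x z <= q * a * c.
  by rewrite -mulrA -(bdensity_card R (triad_bXZ G)) sum_bind_le.
have dd p' : lambda <= p' -> 0 <= d <= p' by rewrite (ltW d0) => /(le_trans d_lambda).
have c4P : cycle4 X' Y' (Pc col) <= 16 * p ^+ 4 * a ^+ 2 * b ^+ 2.
  apply: le_trans (cycle4_le (dd _ lambda_XY) cP).
  apply: cycle4_sub => [||x y]; rewrite ?finset.subsetIl // /Pc /bind /=.
  by case: (_ \in _); rewrite /= ?lexx //; case: (_ == _); rewrite ?lexx ?ler01.
have c4S : cycle4 Y' Z' S <= 16 * s ^+ 4 * b ^+ 2 * c ^+ 2.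
  apply: le_trans (cycle4_le (dd _ lambda_YZ) cS).
  by apply: cycle4_sub => [||x y]; rewrite ?finset.subsetIl // bind0 lexx.
have c4P0 : 0 <= cycle4 X' Y' (Pc col).
  by do 4![apply: sumr_ge0 => ? _]; rewrite !mulr_ge0 // /Pc.
have c4S0 : 0 <= cycle4 Y' Z' S.
  by do 4![apply: sumr_ge0 => ? _]; rewrite !mulr_ge0.
have Yb : #|Y'|%:R <= b by rewrite ler_nat subset_leq_card // finset.subsetIl.
have small := eps_small; set tau := kappa ^+ 3 / 8 in T small.
have tau0 : 0 < tau by rewrite divr_gt0 // exprn_gt0.
set w := p * q * s * (a * b * c) in T.
have pqs0 : 0 < p * q * s := mulr_gt0 (mulr_gt0 p0 q0) s0.
have abc0 : 0 < a * b * c := mulr_gt0 (mulr_gt0 a0 b0) c0.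
have w0 : 0 < w by exact: mulr_gt0.
have lower : (tau * w) ^+ 8 <= 256 * (p * q * s) ^+ 4 * (a * b * c) ^+ 6 * O.
  apply: (@le_trans _ _ (t ^+ 8)).
    by apply: lerXn2r => //; rewrite nnegrE ?(le_trans _ T) // ltW // mulr_gt0.
  apply: le_trans T8 _.
  rewrite (_ : 256 * _ * _ * _ = (q * a * c) ^+ 4 *
    (b ^+ 2 * (16 * s ^+ 4 * b ^+ 2 * c ^+ 2)) * (16 * p ^+ 4 * a ^+ 2 * b ^+ 2) * O); last by ring.
  apply: ler_wpM2r => //.
  have b2 : #|Y'|%:R ^+ 2 <= b ^+ 2 by apply: lerXn2r; rewrite ?nnegrE.
  have e4 : (\sum_(z in Z') \sum_(x in X') Q x z) ^+ 4 <= (q * a * c) ^+ 4.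
    by apply: lerXn2r => //; rewrite nnegrE (le_trans e0).
  apply: ler_pM => //; first by rewrite !mulr_ge0 ?exprn_ge0.
  apply: ler_pM => //; rewrite ?exprn_ge0 //; first by rewrite mulr_ge0 ?exprn_ge0.
  by apply: ler_pM => //; rewrite exprn_ge0.
have lower' : tau ^+ 8 * (p * q * s) ^+ 4 * (a * b * c) ^+ 2 <= 256 * O.
  have pos : 0 < (p * q * s) ^+ 4 * (a * b * c) ^+ 6.
    by rewrite mulr_gt0 ?exprn_gt0.
  rewrite -(ler_pM2l pos); apply: le_trans (_ : (tau * w) ^+ 8 <= _).
    by rewrite le_eqVlt; apply/orP; left; apply/eqP; rewrite /w; ring.
  by apply: (le_trans lower); rewrite le_eqVlt; apply/orP; left; apply/eqP; ring.
(* The densities witnessing [dev23] are only known within [d ^+ 4] of the true ones. As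
   [d ^+ 4 <= d <= lambda], they are at most twice as large, so their fourth powers cost [2 ^+ 4]
   each. *)
have d4 : d ^+ 4 <= d.
  rewrite (_ : d ^+ 4 = d ^+ 3 * d); last by ring.
  by apply: ler_piMl; [exact: ltW|apply: exprn_ile1 => //; exact: ltW].
have near (p' : R) (dp : R) : lambda <= p' -> `|p' - dp| <= d ^+ 4 -> 0 < dp -> 0 <= dp <= 2 * p'.
  move=> lp; rewrite ler_distlC => /andP[_ h] dp0; rewrite (ltW dp0) /=; have := d_lambda; lra.
have [/near hXY _] := devP; have [/near hXZ _] := devQ; have [/near hYZ _] := devS.
have /andP[_ uXY] := hXY lambda_XY dXY0.
have /andP[_ uXZ] := hXZ lambda_XZ dXZ0.
have /andP[_ uYZ] := hYZ lambda_YZ dYZ0.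
have up : octahedron (tX G) (tY G) (tZ G) (tdev R G) <=
    eps * 2 ^+ 12 * (p * q * s) ^+ 4 * (a * b * c) ^+ 2.
  apply: le_trans (_ : eps * dXY ^+ 4 * dXZ ^+ 4 * dYZ ^+ 4 * a ^+ 2 * b ^+ 2 * c ^+ 2 <= _).
    apply: le_trans oct; rewrite le_eqVlt; apply/orP; left; apply/eqP.
    do 4![apply: eq_bigr => ? _]; rewrite sqr_sum_expand.
    by do 2![apply: eq_bigr => ? _]; rewrite !big_bool /=; ring.
  rewrite (_ : _ * (a * b * c) ^+ 2 = eps * (2 * p) ^+ 4 * (2 * q) ^+ 4 * (2 * s) ^+ 4 *
    a ^+ 2 * b ^+ 2 * c ^+ 2); last by ring.
  do 3!(apply: ler_wpM2r; first exact: exprn_ge0).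
  have X4 (x y : R) : 0 < x -> x <= y -> x ^+ 4 <= y ^+ 4.
    by move=> x0 xy; apply: lerXn2r => //; rewrite nnegrE ltW // (lt_le_trans x0).
  have P4 (x : R) : 0 < x -> 0 <= x ^+ 4 by move=> ?; rewrite exprn_ge0 // ltW.
  apply: ler_pM; [|exact: P4| |exact: X4].
    by rewrite !mulr_ge0 ?P4 // ltW.
  apply: ler_pM; [|exact: P4| |exact: X4].
    by rewrite !mulr_ge0 ?P4 // ltW.
  by apply: ler_wpM2l; [exact: ltW|exact: X4].
have W0 : 0 < (p * q * s) ^+ 4 * (a * b * c) ^+ 2 by rewrite mulr_gt0 ?exprn_gt0.
have : eps * 2 ^+ 28 * ((p * q * s) ^+ 4 * (a * b * c) ^+ 2) <
  tau ^+ 8 * ((p * q * s) ^+ 4 * (a * b * c) ^+ 2) by rewrite ltr_pM2r.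
apply/negP; rewrite -leNgt mulrA; apply: (le_trans lower').
have : O <= 4 ^+ 4 * (eps * 2 ^+ 12 * (p * q * s) ^+ 4 * (a * b * c) ^+ 2).
  by rewrite mulrC -ler_pdivrMr ?exprn_gt0 //; exact: le_trans octge up.
rewrite -(ler_pM2l (_ : 0 < 256 :> R)) // => /le_trans; apply.
by rewrite le_eqVlt; apply/orP; left; apply/eqP; ring.
Qed.

End Triad.

(** * Blow-ups inside Trip *)

(** Isomorphisms and restrictions compose, so every member of the closure is carried by one
    injection into a single [Trip H] that preserves and reflects edges. *)
Lemma Trip_class_embedding (HH : graph3 -> Prop) (G : graph3) : Trip_class HH G ->
  exists2 H, HH H & exists2 f : G -> Trip H, injective f &
    forall e : {set G}, (f @: e \in edges3 (Trip H)) = (e \in edges3 G).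
Proof.
elim=> {G} [_ [H HHH ->]|G K [g [g' gK g'K] gE] _ [H HHH [f f_inj fE]]
  |G A _ [H HHH [f f_inj fE]]]; exists H => //.
- by exists id => // e; rewrite imset_id.
- exists (f \o g') => [x y /f_inj /(can_inj g'K)//|e].
  by rewrite imset_comp fE -gE -imset_comp (eq_imset _ (g'K : (g \o g') =1 id)) imset_id.
- exists (f \o val) => [x y /f_inj /val_inj//|e].
  by rewrite imset_comp fE inE.
Qed.

Section TripColour.
Variable H : graph3.

(** [option bool] serves as a set of three colours, one for each copy of the vertex set. *)
Definition trip_colour (x : Trip H) : option bool :=
  match x with inl (inl _) => None | inl (inr _) => Some false | inr _ => Some true end.

Definition trip_base (x : Trip H) : H :=
  match x with inl (inl v) => v | inl (inr v) => v | inr v => v end.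

Lemma trip_colour_base_inj x y :
  trip_colour x = trip_colour y -> trip_base x = trip_base y -> x = y.
Proof. by case: x => [[x|x]|x]; case: y => [[y|y]|y] //= _ ->. Qed.

Lemma trip_edgesE (x y z : Trip H) :
  ([set x; y; z] \in edges3 (Trip H)) =
  [&& trip_colour x != trip_colour y, trip_colour x != trip_colour z,
      trip_colour y != trip_colour z
    & [set trip_base x; trip_base y; trip_base z] \in edges3 H].
Proof.
have perm (T : finType) (u v w : T) :
    ([set u; w; v] = [set u; v; w]) * ([set w; u; v] = [set u; v; w]).
  by split; apply/setP => t; rewrite !inE;
    case: (t == u); case: (t == v); case: (t == w).
have edge v v' v'' : ([set trip_a v; trip_b v'; trip_c v''] \in edges3 (Trip H)) =
    ([set v; v'; v''] \in edges3 H).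
  rewrite inE; apply/existsP/idP => [[u /existsP[u' /existsP[u'' /andP[uE /eqP/setP s]]]]|vE].
    have := s (trip_a u); have := s (trip_b u'); have := s (trip_c u'').
    rewrite !inE !eqxx ?orbT /= => /eqP[<-].
    rewrite orbF => /eqP[<-]; rewrite !orbF => /eqP[<-] //.
  by exists v; apply/existsP; exists v'; apply/existsP; exists v''; rewrite vE eqxx.
have no_edge u v w : trip_colour u = trip_colour v ->
    [set u; v; w] \in edges3 (Trip H) = false.
  move=> uv; apply/negbTE/negP; rewrite inE => /existsP[r /existsP[r' /existsP[r'' /andP[_ /eqP/setP s]]]].
  have := s (trip_a r); have := s (trip_b r'); have := s (trip_c r'').
  rewrite !inE !eqxx ?orbT /=.
  by case: u uv {s} => [[u|u]|u]; case: v => [[v|v]|v]; case: w => [[w|w]|w].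
have [xy|xy] := eqVneq (trip_colour x) (trip_colour y); first exact: no_edge.
have [xz|xz] := eqVneq (trip_colour x) (trip_colour z).
  by rewrite (perm _ x z y).1 (no_edge _ _ _ xz).
have [yz|yz] := eqVneq (trip_colour y) (trip_colour z).
  by rewrite (perm _ y z x).2 (no_edge _ _ _ yz).
have tr (e : {set Trip H}) (e' : {set H}) u v w :
    e = [set trip_a u; trip_b v; trip_c w] -> e' = [set u; v; w] ->
    (e \in edges3 (Trip H)) = (e' \in edges3 H).
  by move=> -> ->; exact: edge.
(* The three colours are now distinct, which leaves the six orders of the copies. *)
case: x xy xz => [[x|x]|x]; case: y yz => [[y|y]|y]; case: z => [[z|z]|z] //= _ _ _;
  [apply: (@tr _ _ x y z)|apply: (@tr _ _ x z y)|apply: (@tr _ _ y x z)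
  |apply: (@tr _ _ z x y)|apply: (@tr _ _ y z x)|apply: (@tr _ _ z y x)];
  by apply/setP => t; rewrite !inE; do 3 case: (t == _).
Qed.

End TripColour.

Lemma otimes_edgesE (k : nat) (G : sgraph) (x y : G) (z : 'I_k) :
  ([set inl x; inl y; inr z] \in edges3 (otimes k G)) = sadj x y.
Proof.
rewrite inE; apply/existsP/idP => [[u /existsP[v /existsP[w /andP[uv /eqP/setP s]]]]|xy].
  have := s (inl u); have := s (inl v); rewrite !inE !eqxx ?orbT !orbF /=.
  case/orP=> /eqP[vE]; case/orP=> /eqP[uE]; move: uv; rewrite uE vE ?sadj_irr //.
  by rewrite sadj_sym.
by exists x; apply/existsP; exists y; apply/existsP; exists z; rewrite xy eqxx.
Qed.

(** An edge of [Trip H] uses all three colours, so in an embedded copy of [k (x) U(k)] the vertices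
    [a_i], the vertices [b_S] with [S] nonempty, and the vertices [c_l] each have one colour. Within
    a colour the projection to [H] is injective, and across the three colours it preserves edges and
    non-edges. Any bipartite relation is read off from suitable sets [S]. *)
Lemma hereditary_blowup (HH : graph3 -> Prop) (I J K : finType) (rel : I -> J -> bool) :
  hereditary3 HH ->
  (forall k : nat, (1 <= k)%N -> Trip_class HH (otimes k (Ugraph k))) ->
  (0 < #|K|)%N ->
  exists2 H : graph3, HH H /\ (#|H| <= #|I| + #|J| + #|K|)%N &
  exists (vA : I -> H) (vB : J -> H) (vC : K -> H),
    [/\ injective vA, injective vB, injective vC &
        forall i j z, ([set vA i; vB j; vC z] \in edges3 H) = rel i j].
Proof.
move=> [_ HH_induced] HH_Trip /card_gt0P[z0 _].
pose k := #|{: I + J + K}|.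
have k0 : (0 < k)%N by apply/card_gt0P; exists (inr z0).
pose phi (x : I + J + K) : 'I_k := enum_rank x.
have phi_inj : injective phi := enum_rank_inj.
have [H HHH [f f_inj fE]] := Trip_class_embedding (HH_Trip k k0).
pose a (i : 'I_k) : otimes k (Ugraph k) := inl (inl i).
pose b (S : {set 'I_k}) : otimes k (Ugraph k) := inl (inr S).
pose c (i : 'I_k) : otimes k (Ugraph k) := inr i.
have edgeE i S l : ([set f (a i); f (b S); f (c l)] \in edges3 (Trip H)) = (i \in S).
  rewrite -[RHS]/(@sadj (Ugraph k) (inl i) (inr S)) -(otimes_edgesE _ _ l) -fE.
  by rewrite !imsetU !imset_set1.
pose col x := trip_colour (f x).
have colE i (S : {set 'I_k}) l : i \in S ->
    [/\ col (a i) != col (b S), col (a i) != col (c l) & col (b S) != col (c l)].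
  by rewrite -(edgeE i S l) trip_edgesE => /and4P[].
pose o := phi (inr z0).
have third (x y u v : option bool) : u != v -> x != u -> x != v -> y != u -> y != v -> x = y.
  by case: u v x y => [[]|] [[]|] [[]|] [[]|].
have [aF ac Fc] := colE o [set: 'I_k]%SET o (finset.in_setT _).
have colA i : col (a i) = col (a o).
  have [h1 h2 _] := colE i [set: 'I_k]%SET o (finset.in_setT _).
  exact: (third _ _ _ _ Fc).
have colC l : col (c l) = col (c o).
  have [_ h1 h2] := colE o [set: 'I_k]%SET l (finset.in_setT _).
  by apply: (third _ _ _ _ aF); rewrite 1?eq_sym.
(* The vertex [b set0] lies in no edge and its colour is not determined, hence the demand for an
   element of [S]. *)
have colB i (S : {set 'I_k}) : i \in S -> col (b S) = col (b [set: 'I_k]%SET).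
  move=> iS; have [h1 h2 h3] := colE i S o iS.
  by apply: (third _ _ _ _ ac) => //; rewrite 1?eq_sym // -(colA i).
(* The set encodes the neighbours of [j], together with a private label of [j] that makes it
   nonempty and makes [SB] injective. *)
pose SB j : {set 'I_k} := phi (inl (inr j)) |: [set phi (inl (inl i)) | i : I & rel i j].
have SBj j : phi (inl (inr j)) \in SB j by rewrite setU11.
have SBE i j : (phi (inl (inl i)) \in SB j) = rel i j.
  rewrite /SB in_setU1 (inj_eq phi_inj) /=.
  by apply/imsetP/idP => [[i' + /phi_inj[->]]|ij]; rewrite ?inE //; exists i; rewrite ?inE.
have SB_inj : injective SB.
  move=> j j' jj'; have := SBj j; rewrite jj' in_setU1 => /orP[/eqP/phi_inj[]//|].
  by case/imsetP=> i _ /phi_inj.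
pose wA i := trip_base (f (a (phi (inl (inl i))))).
pose wB j := trip_base (f (b (SB j))).
pose wC z := trip_base (f (c (phi (inr z)))).
have wA_inj : injective wA.
  move=> i i' /trip_colour_base_inj; rewrite -!/(col _) !colA => /(_ erefl)/f_inj[].
  by move/phi_inj => [].
have wB_inj : injective wB.
  move=> j j' /trip_colour_base_inj; rewrite -!/(col _) !(colB _ _ (SBj _)) => /(_ erefl)/f_inj[].
  exact: SB_inj.
have wC_inj : injective wC.
  move=> z z' /trip_colour_base_inj; rewrite -!/(col _) !colC => /(_ erefl)/f_inj[].
  by move/phi_inj => [].
have wE i j z : ([set wA i; wB j; wC z] \in edges3 H) = rel i j.
  rewrite -SBE -(edgeE _ (SB j) (phi (inr z))) trip_edgesE -!/(col _).
  by rewrite !colA !colC (colB _ _ (SBj j)) aF ac Fc.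
(* Vertices from different copies may project to the same vertex of [H], so the three images may
   overlap and the size of [W] is only bounded above. *)
pose W : {set H} := wA @: [set: I] :|: wB @: [set: J] :|: wC @: [set: K].
have WA i : wA i \in W by rewrite !inE imset_f ?inE.
have WB j : wB j \in W by rewrite !inE (imset_f wB) ?inE ?orbT.
have WC z : wC z \in W by rewrite !inE (imset_f wC) ?inE ?orbT.
exists (induced3 W).
  split; first exact: HH_induced.
  have -> : #|induced3 W| = #|W| by rewrite card_sig; apply: eq_card => x; rewrite inE.
  apply: leq_trans (leq_card_setU _ _) _; apply: leq_add.
    apply: leq_trans (leq_card_setU _ _) _; apply: leq_add.
      by rewrite -[leqRHS]cardsT leq_imset_card.
    by rewrite -[leqRHS]cardsT leq_imset_card.
  by rewrite -[leqRHS]cardsT leq_imset_card.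
pose sub x (xW : x \in W) : induced3 W := exist (fun x => x \in W) x xW.
exists (fun i => sub _ (WA i)), (fun j => sub _ (WB j)), (fun z => sub _ (WC z)).
split=> [i i' [/wA_inj]|j j' [/wB_inj]|z z' [/wC_inj]|i j z] //.
by rewrite inE !imsetU !imset_set1 /= wE.
Qed.

(** * Irregular triples *)

Lemma sum_card_disjoint_le (I T : finType) (F : I -> {set T}) :
  (forall i j, i != j -> [disjoint F i & F j]) -> (\sum_i #|F i| <= #|T|)%N.
Proof.
move=> dF; under eq_bigr do rewrite -sum1_card big_mkcond /=.
rewrite exchange_big -[leqRHS]sum1_card /=; apply: leq_sum => x _.
have [/existsP[i xi]|no] := boolP [exists i, x \in F i].
  rewrite (bigD1 i) //= xi big1 // => j ji.
  by rewrite (disjointFr (dF i j _)) // eq_sym.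
rewrite big1 // => i _; case: ifP => // xi.
by move: no; rewrite negb_exists => /forallP/(_ i); rewrite xi.
Qed.

Section UnionBounds.
Variables (R : realType).

Lemma card_bigcup_le (I T : finType) (P : pred I) (F : I -> {set T}) (c : I -> R) :
  (forall i, 0 <= c i) -> (forall i, P i -> #|F i|%:R <= c i) ->
  #|\bigcup_(i | P i) F i|%:R <= \sum_i c i.
Proof.
move=> c0 Fc; apply: (@le_trans _ _ (\sum_(i | P i) #|F i|%:R)).
  elim/big_ind2: _ => [|A x B y Ax By|i _]; rewrite ?cards0 //.
  by apply: le_trans (lerD Ax By); rewrite -natrD ler_nat leq_card_setU.
by rewrite [leLHS]big_mkcond; apply: ler_sum => i _; case: ifP => // /Fc.
Qed.

Variables (V : finType) (t l : nat) (D : decomposition V t l) (kappa : R).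
Hypothesis kappa0 : 0 <= kappa.

Lemma sum_card_vpart : \sum_i #|vpart D i|%:R <= #|V|%:R :> R.
Proof. by rewrite -natr_sum ler_nat; apply: sum_card_disjoint_le; case: (vpartP D). Qed.

Lemma card_sparse_parts (A : {set V}) :
  #|\bigcup_(i | #|vpart D i :&: A|%:R < kappa * #|vpart D i|%:R) (vpart D i :&: A)|%:R
  <= kappa * #|V|%:R.
Proof.
apply: le_trans (_ : \sum_i kappa * #|vpart D i|%:R <= _).
  by apply: card_bigcup_le => [i|i /ltW]; rewrite ?mulr_ge0.
by rewrite -mulr_sumr ler_wpM2l // sum_card_vpart.
Qed.

Lemma card_small_parts :
  #|\bigcup_(i | #|vpart D i|%:R * t%:R < kappa * #|V|%:R) vpart D i|%:R
  <= kappa * #|V|%:R.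
Proof.
have [t0|t0] := posnP t.
  rewrite big1 ?cards0 ?mulr_ge0 // => -[i it]; exfalso; by rewrite t0 in it.
have tR : 0 < t%:R :> R by rewrite ltr0n.
apply: le_trans (_ : \sum_(i < t) kappa * #|V|%:R / t%:R <= _).
  apply: card_bigcup_le => [i|i /ltW h]; first by rewrite divr_ge0 ?mulr_ge0.
  by rewrite ler_pdivlMr.
by rewrite sumr_const card_ord -[_ *+ _]mulr_natr divfK // gt_eqF.
Qed.

(** Each of the [l] pieces of [V_i x V_j] contributes less than [kappa / l.+1] of the product when
    it is thin. The successor keeps the threshold positive for [l = 0] as well. *)
Lemma card_thin_pairs :
  #|\bigcup_(i : 'I_t * 'I_t * 'I_l |
      bdensity R (dec_bigraph D i.1.1 i.1.2 i.2) < kappa / l.+1%:R)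
      ppart D i.1.1 i.1.2 i.2|%:R <= kappa * #|V|%:R ^+ 2.
Proof.
have l0 : 0 < l.+1%:R :> R by rewrite ltr0n.
have k0 : 0 <= kappa / l.+1%:R by rewrite divr_ge0.
apply: le_trans (_ : \sum_(i : 'I_t * 'I_t * 'I_l)
    kappa / l.+1%:R * (#|vpart D i.1.1|%:R * #|vpart D i.1.2|%:R) <= _).
  apply: card_bigcup_le => [i|i /ltW h]; first by rewrite !mulr_ge0.
  have := bdensity_card R (dec_bigraph D i.1.1 i.1.2 i.2) => /= ->.
  by rewrite ler_wpM2r ?mulr_ge0.
rewrite -mulr_sumr.
rewrite -(pair_big xpredT xpredT (fun (i : 'I_t * 'I_t) (a : 'I_l) =>
  #|vpart D i.1|%:R * #|vpart D i.2|%:R)) /=.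
under eq_bigr do rewrite sumr_const card_ord.
rewrite -(pair_big xpredT xpredT (fun (i j : 'I_t) =>
  #|vpart D i|%:R * #|vpart D j|%:R *+ l)) /=.
under eq_bigr do (under eq_bigr do rewrite -mulrnAr; rewrite -mulr_sumr sumrMnl).
rewrite -mulr_suml.
set s := \sum_i _.
have s0 : 0 <= s by apply: sumr_ge0.
have sV : s <= #|V|%:R := sum_card_vpart.
have s2 : s * s <= #|V|%:R ^+ 2 by rewrite expr2 ler_pM.
rewrite -mulr_natr (_ : _ * _ = kappa * (s * s) * (l%:R / l.+1%:R)); last by field.
apply: le_trans (_ : kappa * (s * s) <= _); last by rewrite ler_wpM2l.
by rewrite ler_piMr ?mulr_ge0 // ler_pdivrMr // mul1r ler_nat.
Qed.

End UnionBounds.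

Section IrregularTriples.
Variables (R : realType) (H : graph3) (A B C : {set H}) (m n : nat).
Variables (ia : H -> 'I_m) (ib : H -> {set 'I_m}).
Variables (t l N : nat) (D : decomposition H t l) (kappa d eps : R).
Hypothesis m0 : (0 < m)%N.
Hypothesis oedgesE : forall x y z, x \in A -> y \in B -> z \in C ->
  ((x, y, z) \in oedges H) = (ia x \in ib y).
Hypothesis card_ia : forall a, #|[set x in A | ia x == a]|%:R * m%:R <= n%:R :> R.
Hypothesis card_ib : forall b, #|[set y in B | ib y == b]|%:R * 2 ^+ m <= n%:R :> R.
Hypotheses (cardA : #|A| = n) (cardB : #|B| = n) (cardC : #|C| = n).
Hypotheses (tN : (0 < t <= N)%N) (n_le : (n <= #|H|)%N).
Hypothesis kappa0 : 0 < kappa.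
Hypothesis m_large : 4 * N%:R ^+ 2 <= m%:R * kappa ^+ 4.
Hypotheses (d0 : 0 < d) (d1 : d <= 1) (d_lambda : d <= kappa / l.+1%:R).
Hypothesis d_small : 3 * (m%:R * 2 ^+ m) * d <= kappa ^+ 3 / 8 * (kappa / l.+1%:R) ^+ 3.
Hypothesis eps0 : 0 < eps.
Hypothesis eps_small : eps * 2 ^+ 28 < (kappa ^+ 3 / 8) ^+ 8.

Let sparse (E : {set H}) : {set H} :=
  \bigcup_(i | #|vpart D i :&: E|%:R < kappa * #|vpart D i|%:R) (vpart D i :&: E).
Let small : {set H} :=
  \bigcup_(i | #|vpart D i|%:R * t%:R < kappa * #|H|%:R) vpart D i.
Let thin : {set H * H} :=
  \bigcup_(i : 'I_t * 'I_t * 'I_l |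
      bdensity R (dec_bigraph D i.1.1 i.1.2 i.2) < kappa / l.+1%:R)
      ppart D i.1.1 i.1.2 i.2.

(** Avoiding the exceptional sets supplies the hypotheses of [triad_not_dev23]. The parts of [x] and
    [y] meet [A] and [B] in at least [kappa ^+ 2 * n / N] vertices, because [t <= N] and
    [n <= #|H|], and [m_large] then makes the sign matrix balanced between them. *)
Lemma dec_triad_not_dev23 i j k a b c x y z :
  (x, y, z) \in K3 (dec_triad D i j k a b c) ->
  x \in A -> y \in B -> z \in C ->
  x \notin sparse A -> x \notin small -> y \notin sparse B -> y \notin small ->
  z \notin sparse C ->
  (x, y) \notin thin -> (x, z) \notin thin -> (y, z) \notin thin ->
  ~ dev23 (dec_triad D i j k a b c) eps (d ^+ 4).
Proof.
rewrite inE /= => /and5P[xi yj zk xy /andP[xz yz]] xA yB zC xsp xsm ysp ysm zsp txy txz tyz.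
have sparseP (E : {set H}) v i' : v \in vpart D i' -> v \in E -> v \notin sparse E ->
    kappa * #|vpart D i'|%:R <= #|vpart D i' :&: E|%:R.
  move=> vi vE; rewrite leNgt; apply: contra => lt.
  by apply/bigcupP; exists i' => //; rewrite inE vi.
have smallP v i' : v \in vpart D i' -> v \notin small ->
    kappa * #|H|%:R <= #|vpart D i'|%:R * t%:R.
  move=> vi; rewrite leNgt; apply: contra => lt.
  by apply/bigcupP; exists i'.
have thinP v w i' j' a' : (v, w) \in ppart D i' j' a' -> (v, w) \notin thin ->
    kappa / l.+1%:R <= bdensity R (dec_bigraph D i' j' a').
  move=> vw; rewrite leNgt; apply: contra => lt.
  by apply/bigcupP; exists (i', j', a').
have [Xsp Ysp] := (sparseP _ _ _ xi xA xsp, sparseP _ _ _ yj yB ysp).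
have [/andP[t0 tN'] Zsp] := (tN, sparseP _ _ _ zk zC zsp).
have tR : 0 < t%:R :> R by rewrite ltr0n.
have large (E : {set H}) v i' : v \in vpart D i' -> v \notin small ->
    kappa * #|vpart D i'|%:R <= #|vpart D i' :&: E|%:R ->
    kappa ^+ 2 * n%:R <= #|vpart D i' :&: E|%:R * N%:R.
  move=> vi /(smallP _ _ vi) Vs Esp.
  apply: (@le_trans _ _ (#|vpart D i' :&: E|%:R * t%:R)); last by rewrite ler_wpM2l // ler_nat.
  apply: (@le_trans _ _ (kappa * (#|vpart D i'|%:R * t%:R))); last first.
    by rewrite mulrA ler_wpM2r.
  rewrite expr2 -mulrA ler_pM2l //; apply: le_trans Vs.
  by rewrite ler_pM2l // ler_nat.
apply: (@triad_not_dev23 _ _ _ A B C m ia ib n%:R kappa (kappa / l.+1%:R)) => //=;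
  try by [rewrite divr_gt0 ?ltr0n|exact: (thinP x y)|exact: (thinP x z)|exact: (thinP y z)].
have NR : 0 < N%:R :> R by rewrite ltr0n (leq_trans t0).
have LX := large _ _ _ xi xsm Xsp; have LY := large _ _ _ yj ysm Ysp.
set X := #|vpart D i :&: A|%:R in LX *; set Y := #|vpart D j :&: B|%:R in LY *.
have LXY : kappa ^+ 4 * n%:R ^+ 2 <= X * Y * N%:R ^+ 2.
  have k2 : 0 <= kappa ^+ 2 * n%:R by rewrite mulr_ge0 ?sqr_ge0.
  have := ler_pM k2 k2 LX LY.
  by rewrite (_ : kappa ^+ 4 * _ = kappa ^+ 2 * n%:R * (kappa ^+ 2 * n%:R)) 1?(_ : X * Y * _ = X * N%:R * (Y * N%:R)) //; ring.
rewrite -(ler_pM2r (_ : 0 < N%:R ^+ 2)) ?exprn_gt0 //.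
apply: (@le_trans _ _ (m%:R * kappa ^+ 4 * n%:R ^+ 2)).
  by rewrite mulrAC ler_wpM2r // sqr_ge0.
rewrite (_ : m%:R * X * Y * N%:R ^+ 2 = m%:R * (X * Y * N%:R ^+ 2)); last by ring.
by rewrite -(mulrA m%:R) ler_wpM2l.
Qed.

(** Every triple of [A x B x C] is either irregular or has a vertex or pair in an exceptional set.
    There are eight ways for the latter, two each for [x] and [y], one for [z], three for the pairs,
    and each covers at most [kappa * #|H| ^+ 3] triples. *)
Lemma irregular_triples : dev23_regular D eps (d ^+ 4) ->
  n%:R ^+ 3 <= (eps + 8 * kappa) * #|H|%:R ^+ 3.
Proof.
rewrite /dev23_regular; set bad := ~: _ => badle.
(* These rearrangements carry [thin x H] to the triples whose pair [(x, z)], respectively [(y, z)],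
   is thin. *)
pose xz (p : H * H * H) := (p.1.1, p.2, p.1.2).
pose yz (p : H * H * H) := (p.2, p.1.1, p.1.2).
pose T1 : {set H} := [set: H]. pose T2 : {set H * H} := [set: H * H].
pose S1 := finset.setX (finset.setX (sparse A) T1) T1.
pose S2 := finset.setX (finset.setX small T1) T1.
pose S3 := finset.setX (finset.setX T1 (sparse B)) T1.
pose S4 := finset.setX (finset.setX T1 small) T1.
pose S5 := finset.setX T2 (sparse C).
pose S6 := finset.setX thin T1.
pose S7 := xz @: S6. pose S8 := yz @: S6.
have sub : finset.setX (finset.setX A B) C \subset
    bad :|: S1 :|: S2 :|: S3 :|: S4 :|: S5 :|: S6 :|: S7 :|: S8.
  apply/fintype.subsetP => -[[x y] z]; rewrite !finset.in_setX /= => /andP[/andP[xA yB] zC].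
  apply: contraT; rewrite !finset.in_setU !negb_or !finset.in_setX !finset.in_setT !andbT -!andbA /=.
  case/and5P => nbad x1 x2 y1 /and5P[y2 z1 txy nS7 nS8].
  have txz : (x, z) \notin thin.
    by apply: contra nS7 => th; apply/imsetP; exists (x, z, y); rewrite ?finset.in_setX ?th ?finset.in_setT.
  have tyz : (y, z) \notin thin.
    by apply: contra nS8 => th; apply/imsetP; exists (y, z, x); rewrite ?finset.in_setX ?th ?finset.in_setT.
  move: nbad; rewrite finset.in_setC negbK inE => /asboolP[i [j [k [a [b [c [pK dev]]]]]]].
  by have := dec_triad_not_dev23 pK xA yB zC x1 x2 y1 y2 z1 txy txz tyz dev.
have cU (E F : {set H * H * H}) (e f : R) : #|E|%:R <= e -> #|F|%:R <= f ->
    #|E :|: F|%:R <= e + f.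
  by move=> Ee Ff; apply: le_trans (lerD Ee Ff); rewrite -natrD ler_nat leq_card_setU.
have k0 := ltW kappa0; set h : R := #|H|%:R in badle *.
have h0 : 0 <= h by [].
have h2 : 0 <= h * h by rewrite mulr_ge0.
have spE (E : {set H}) : #|sparse E|%:R * (h * h) <= kappa * h ^+ 3.
  rewrite (_ : kappa * _ = kappa * h * (h * h)); last by ring.
  by rewrite ler_wpM2r // card_sparse_parts.
have smE : #|small|%:R * (h * h) <= kappa * h ^+ 3.
  rewrite (_ : kappa * _ = kappa * h * (h * h)); last by ring.
  by rewrite ler_wpM2r // card_small_parts.
have thE : #|S6|%:R <= kappa * h ^+ 3.
  rewrite cardsX natrM cardsT -/h (_ : kappa * _ = kappa * h ^+ 2 * h); last by ring.
  by rewrite ler_wpM2r // card_thin_pairs.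
have c1 (E : {set H}) : #|finset.setX (finset.setX E T1) T1|%:R = #|E|%:R * (h * h).
  by rewrite !cardsX !natrM !cardsT mulrA.
have c2 (E : {set H}) : #|finset.setX (finset.setX T1 E) T1|%:R = #|E|%:R * (h * h).
  by rewrite !cardsX !natrM !cardsT -/h; ring.
have c3 : #|S5|%:R = #|sparse C|%:R * (h * h).
  by rewrite !cardsX !natrM !cardsT card_prod natrM -/h; ring.
have : #|finset.setX (finset.setX A B) C|%:R <= eps * h ^+ 3 + kappa * h ^+ 3
    + kappa * h ^+ 3 + kappa * h ^+ 3 + kappa * h ^+ 3 + kappa * h ^+ 3
    + kappa * h ^+ 3 + kappa * h ^+ 3 + kappa * h ^+ 3.
  apply: le_trans (_ : #|bad :|: S1 :|: S2 :|: S3 :|: S4 :|: S5 :|: S6 :|: S7 :|: S8|%:R <= _).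
    by rewrite ler_nat subset_leq_card.
  have leS6 g : #|[set g p | p in S6] : {set H * H * H}|%:R <= kappa * h ^+ 3.
    by apply: le_trans thE; rewrite ler_nat leq_imset_card.
  have p1 : #|S1|%:R <= kappa * h ^+ 3 by rewrite c1.
  have p2 : #|S2|%:R <= kappa * h ^+ 3 by rewrite c1.
  have p3 : #|S3|%:R <= kappa * h ^+ 3 by rewrite c2.
  have p4 : #|S4|%:R <= kappa * h ^+ 3 by rewrite c2.
  have p5 : #|S5|%:R <= kappa * h ^+ 3 by rewrite c3.
  exact: (cU _ _ _ _ (cU _ _ _ _ (cU _ _ _ _ (cU _ _ _ _ (cU _ _ _ _ (cU _ _ _ _ (cU _ _ _ _ (cU _ _ _ _ badle p1) p2) p3) p4) p5) thE) (leS6 xz)) (leS6 yz)).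
rewrite !cardsX cardA cardB cardC !natrM (_ : _ * _ * _ = n%:R ^+ 3); last by ring.
by move/le_trans; apply; rewrite le_eqVlt; apply/orP; left; apply/eqP; ring.
Qed.

End IrregularTriples.

(** * Choice of the 3-graph and of the parameters *)

Lemma hereditary_membership_blowup (HH : graph3 -> Prop) (m r : nat) :
  hereditary3 HH ->
  (forall k : nat, (1 <= k)%N -> Trip_class HH (otimes k (Ugraph k))) ->
  (0 < m)%N -> (0 < r)%N ->
  let n := (m * (r * 2 ^ m))%N in
  exists2 H : graph3, HH H /\ (n <= #|H| <= 3 * n)%N &
  exists (A B C : {set H}) (ia : H -> 'I_m) (ib : H -> {set 'I_m}),
    [/\ [/\ #|A| = n, #|B| = n & #|C| = n],
        forall a, (#|[set x in A | ia x == a]| * m <= n)%N,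
        forall b, (#|[set y in B | ib y == b]| * 2 ^ m <= n)%N &
        forall x y z, x \in A -> y \in B -> z \in C ->
          ((x, y, z) \in oedges H) = (ia x \in ib y)].
Proof.
move=> her HTrip m0 r0 n.
have n0 : (0 < n)%N by rewrite !muln_gt0 m0 r0 expn_gt0.
have cS : #|{set 'I_m}| = (2 ^ m)%N by rewrite -cardsT -powersetT card_powerset cardsT card_ord.
(* The size [n] is divisible by [m] and by [2 ^ m], so both sides split into blocks of exactly equal
   size; the second coordinate numbers the vertices of a block. *)
pose I := ('I_m * 'I_(r * 2 ^ m))%type; pose J := ({set 'I_m} * 'I_(r * m))%type.
have cI : #|{: I}| = n by rewrite card_prod !card_ord.
have cJ : #|{: J}| = n by rewrite card_prod cS card_ord /n; lia.
have K0 : (0 < #|'I_n|)%N by rewrite card_ord.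
have [H [HHH cH] [vA [vB [vC [iA iB iC E]]]]] :=
  @hereditary_blowup HH I J 'I_n (fun i j => i.1 \in j.1) her HTrip K0.
exists H.
  split=> //; rewrite cI cJ card_ord in cH.
  rewrite (leq_trans cH) ?andbT; last by lia.
  by rewrite -[leqLHS]card_ord -(card_codom iC) max_card.
(* [ia] and [ib] invert the embeddings; off the images they take arbitrary default values. *)
pose ia x := if [pick i | vA i == x] is Some i then i.1 else Ordinal m0.
pose ib y := if [pick j | vB j == y] is Some j then j.1 else finset.set0.
have iaE i : ia (vA i) = i.1.
  by rewrite /ia; case: pickP => [i' /eqP/iA->//|/(_ i)]; rewrite eqxx.
have ibE j : ib (vB j) = j.1.
  by rewrite /ib; case: pickP => [j' /eqP/iB->//|/(_ j)]; rewrite eqxx.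
exists (vA @: [set: I]), (vB @: [set: J]), (vC @: [set: 'I_n]), ia, ib; split.
- by rewrite !card_imset // !cardsT cI cJ card_ord.
- move=> a; apply: (@leq_trans ((r * 2 ^ m) * m)); last by rewrite /n mulnC.
  rewrite leq_mul2r; apply/orP; right.
  rewrite -[leqRHS](card_ord (r * 2 ^ m)) -cardsT.
  apply: leq_trans (leq_imset_card (fun s => vA (a, s)) _); apply: subset_leq_card.
  apply/fintype.subsetP => x; rewrite inE => /andP[/imsetP[[a' s] _ ->]].
  by rewrite iaE => /eqP <-; apply/imsetP; exists s.
- move=> b; apply: (@leq_trans ((r * m) * 2 ^ m)); last by rewrite /n; lia.
  rewrite leq_mul2r; apply/orP; right.
  rewrite -[leqRHS](card_ord (r * m)) -cardsT.
  apply: leq_trans (leq_imset_card (fun s => vB (b, s)) _); apply: subset_leq_card.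
  apply/fintype.subsetP => x; rewrite inE => /andP[/imsetP[[b' s] _ ->]].
  by rewrite ibE => /eqP <-; apply/imsetP; exists s.
- move=> x y z /imsetP[i _ ->] /imsetP[j _ ->] /imsetP[k _ ->].
  by rewrite inE /= E iaE ibE.
Qed.

(** The number [m] of blocks depends on [N] and [kappa] only, so [eps2] may depend on it. If some
    [T < N] were a bound, a blow-up larger than [n0] would have a regular decomposition with at most
    [N] parts, against [irregular_triples]. *)
Lemma T_bound_ge (R : realType) (HH : graph3 -> Prop) (kappa eps1 : R) (N : nat) :
  hereditary3 HH ->
  (forall k : nat, (1 <= k)%N -> Trip_class HH (otimes k (Ugraph k))) ->
  0 < kappa <= 1 -> 0 < eps1 -> eps1 * 2 ^+ 28 < (kappa ^+ 3 / 8) ^+ 8 ->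
  (eps1 + 8 * kappa) * 27 < 1 ->
  exists2 eps2 : nat -> R, (forall l, 0 < eps2 l <= 1)
    & forall T, T_bound HH eps1 eps2 T -> (N <= T)%N.
Proof.
move=> her HTrip /andP[kappa0 kappa1] eps0 eps_small small.
have k4 : 0 < kappa ^+ 4 by rewrite exprn_gt0.
have [m m_large] : exists m : nat, 4 * N%:R ^+ 2 <= m.+1%:R * kappa ^+ 4.
  exists (Num.trunc (4 * N%:R ^+ 2 / kappa ^+ 4)).
  by rewrite -ler_pdivrMr // ltW // truncnS_gt.
pose M : R := 3 * (m.+1%:R * 2 ^+ m.+1).
have M1 : 1 <= M.
  rewrite /M -natrX -!natrM ler1n !muln_gt0 /= expn_gt0 //.
have M0 : 0 < M by exact: lt_le_trans M1.
pose lambda l : R := kappa / l.+1%:R.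
(* With this value [d_small] holds with equality. *)
pose d l := kappa ^+ 3 / 8 * lambda l ^+ 3 / M.
have lambda01 l : 0 < lambda l <= 1.
  by rewrite divr_gt0 ?ltr0n //= ler_pdivrMr ?ltr0n // mul1r (le_trans kappa1) // ler1n.
have d0 l : 0 < d l.
  have /andP[l0 _] := lambda01 l.
  by rewrite divr_gt0 // mulr_gt0 ?divr_gt0 ?exprn_gt0.
have dM l : M * d l = kappa ^+ 3 / 8 * lambda l ^+ 3 by rewrite mulrC divfK // gt_eqF.
have d_lambda l : d l <= lambda l.
  have /andP[l0 l1] := lambda01 l; have k3 : kappa ^+ 3 <= 1 by rewrite exprn_ile1 // ltW.
  rewrite ler_pdivrMr //; apply: (@le_trans _ _ (lambda l)); last by rewrite ler_peMr // ltW.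
  rewrite (_ : lambda l ^+ 3 = lambda l ^+ 2 * lambda l); last by ring.
  rewrite mulrA; apply: ler_piMl; first exact: ltW.
  apply: mulr_ile1; [by rewrite divr_ge0 // exprn_ge0 // ltW|by rewrite sqr_ge0| |].
    by rewrite ler_pdivrMr // mul1r (le_trans k3) // ler1n.
  by rewrite exprn_ile1 // ltW.
have d1 l : d l <= 1.
  by have /andP[_ l1] := lambda01 l; exact: le_trans (d_lambda l) l1.
exists (fun l => d l ^+ 4) => [l|T [L [n0 [_ HT]]]].
  by rewrite exprn_gt0 //= exprn_ile1 // ltW.
rewrite leqNgt; apply/negP => TN.
have [H [HHH /andP[nH Hn]] [A [B [C [ia [ib [[cA cB cC] hA hB hE]]]]]]] :=
  hereditary_membership_blowup her HTrip (ltn0Sn m) (ltn0Sn n0).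
set n := (_ * _)%N in nH Hn cA cB cC hA hB.
have nn0 : (n0 < n)%N.
  by rewrite /n mulnCA leq_pmulr // muln_gt0 expn_gt0.
have [t [l [/andP[t0 tT] _ [D [_ reg]]]]] := HT H HHH (ltnW (leq_trans nn0 nH)).
have tN : (0 < t <= N)%N by rewrite t0 (leq_trans tT) // ltnW.
have hA' a : #|[set x in A | ia x == a]|%:R * m.+1%:R <= n%:R :> R by rewrite -natrM ler_nat.
have hB' b : #|[set y in B | ib y == b]|%:R * 2 ^+ m.+1 <= n%:R :> R.
  by rewrite -natrX -natrM ler_nat.
have dM' : M * d l <= kappa ^+ 3 / 8 * lambda l ^+ 3 by rewrite dM.
have := irregular_triples (ltn0Sn m) hE hA' hB' cA cB cC tN nH kappa0 m_large
  (d0 l) (d1 l) (d_lambda l) dM' eps0 eps_small reg.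
have n3 : 0 < n%:R ^+ 3 :> R by rewrite exprn_gt0 // ltr0n (leq_ltn_trans _ nn0).
(* As [#|H| <= 3 * n], the triples of [A x B x C] are at least a 27th of all triples, more than the
   share [eps1 + 8 * kappa] that may be lost. *)
have H3 : #|H|%:R ^+ 3 <= 27 * n%:R ^+ 3 :> R.
  rewrite (_ : 27 * _ = (3 * n%:R) ^+ 3); last by ring.
  by apply: lerXn2r; rewrite ?nnegrE ?mulr_ge0 // -natrM ler_nat.
apply/negP; rewrite -ltNge; apply: (@le_lt_trans _ _ ((eps1 + 8 * kappa) * (27 * n%:R ^+ 3))).
  by rewrite ler_wpM2l // addr_ge0 ?mulr_ge0 // ltW.
by rewrite mulrA -[ltRHS]mul1r ltr_pM2r.
Qed.

Unset Implicit Arguments.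

Theorem theorem1p8 (R : realType) (HH : graph3 -> Prop)
  (HH_hereditary : hereditary3 HH)
  (HH_Trip : forall k : nat, (1 <= k)%N -> Trip_class HH (otimes k (Ugraph k))) :
  exists c epsstar : R, [/\ 0 < c, 0 < epsstar
    & forall eps1 : R, 0 < eps1 < epsstar ->
      exists2 eps2 : nat -> R, (forall n, 0 < eps2 n <= 1)
        & (((wowzerR (c * eps1 `^ (- 7^-1)))%:R)%:E <= T_growth HH eps1 eps2)%E].
Proof.
pose kappa : R := 1000^-1.
have kappa01 : 0 < kappa <= 1 by rewrite invr_gt0 ltr0n invf_le1 ?ltr0n // ler1n.
have /andP[kappa0 _] := kappa01.
(* The first bound gives [(eps1 + 8 * kappa) * 27 < 243 / 1000], the second is the smallness
   required by the octahedron count. *)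
pose epsstar := Num.min kappa ((kappa ^+ 3 / 8) ^+ 8 / 2 ^+ 28).
(* Since [T_bound_ge] reaches every prescribed [N], the constant [c = 1] serves. *)
exists 1, epsstar; split=> // [|eps1 /andP[eps0]].
  by rewrite lt_min kappa0 !(exprn_gt0, divr_gt0).
rewrite lt_min => /andP[eps_kappa]; rewrite ltr_pdivlMr ?exprn_gt0 // => eps_small.
have small : (eps1 + 8 * kappa) * 27 < 1 by move: eps_kappa; rewrite /kappa; lra.
have [eps2 eps2P T_ge] := T_bound_ge (wowzerR (1 * eps1 `^ (- 7^-1)))
  HH_hereditary HH_Trip kappa01 eps0 eps_small small.
exists eps2 => //; apply: le_ereal_inf_tmp => _ [T /= /T_ge NT <-].
by rewrite lee_fin ler_nat.
Qed.
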